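(* Let $J=\mathbb R$ or $J=[0,\infty)$, and let $H$ be a separable infinite dimensional Hilbert space. Then there exists $f\in EAP_0(J,H)$ such that: (i) $|f|$ and $|f|^2$ belong to $AP(J,\mathbb R)$ (and hence to $EAP(J,\mathbb R)$), where $|f|(t)=\|f(t)\|$ and $|f|^2(t)=\|f(t)\|^2$; (ii) the range $f(J)$ is not relatively norm compact in $H$; (iii) the means $m_B(|f|)$ and $m_B(|f|^2)$ exist and are $>0$; (iv) the Parseval equation fails for $f$, and $f$ is not pseudo almost periodic, i.e. $f\notin PAP(J,H)$.
   Context: For a (real or complex) Banach space $X$ and $J\in\{[0,\infty),\mathbb R\}$, $C_b(J,X)$ denotes the Banach space of bounded continuous functions $f:J\to X$ with norm $\|f\|=\sup_{t\in J}\|f(t)\|$. For $s\in J$, $f_s(t):=f(s+t)$, $t\in J$, and the orbit of $f$ is $O(f):=\{f_s: s\in J\}$. $EAP(J,X)$ (Eberlein almost periodic functions) is the set of $f\in C_b(J,X)$ such that $O(f)$ is relatively weakly compact in $C_b(J,X)$. $EAP_0(J,X)$ is the set of $f\in EAP(J,X)$ such that $0$ belongs to the weak closure of $O(f)$ in $C_b(J,X)$. $AP(\mathbb R,X)$ is the space of (Bohr) almost periodic functions $\mathbb R\to X$, and $AP([0,\infty),X)$ is the set of restrictions to $[0,\infty)$ of functions in $AP(\mathbb R,X)$. For a bounded continuous $g$ on $J$ (scalar or vector valued) the mean is $m_B(g):=\lim_{T\to\infty}\frac1T\int_0^T g(t)\,dt$ if $J=[0,\infty)$, and $m_B(g):=\lim_{T\to\infty}\frac1{2T}\int_{-T}^T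 g(t)\,dt$ if $J=\mathbb R$ (norm limit), when the limit exists. $PAP_0(J,X)$ is the set of $f\in C_b(J,X)$ such that $m_B(|f|)$ exists and equals $0$. The pseudo almost periodic functions are $PAP(J,X):=AP(J,X)+PAP_0(J,X)$. For $f\in EAP(J,H)$ the Fourier coefficients are $c_\lambda(f):=m_B(e^{-i\lambda\,\cdot}f)$, $\lambda\in\mathbb R$ (taken in the complexification of $H$ if $H$ is real); they always exist. The Parseval equation for $f$ is the equation $m_B(|f|^2)=\sum_{\lambda\in\mathbb R}\|c_\lambda(f)\|^2$. *)

(* Defs.v *)
From HB Require Import structures.
From mathcomp Require Import all_boot all_order all_algebra.
From mathcomp Require Import all_classical all_reals all_analysis.
From mathcomp Require Import sesquilinear complex.

Set Implicit Arguments.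
Unset Strict Implicit.
Unset Printing Implicit Defensive.

Import Order.TTheory GRing.Theory Num.Theory.
Import numFieldNormedType.Exports.

Local Open Scope classical_set_scope.
Local Open Scope ring_scope.

Inductive scalar_kind := RealScalars | ComplexScalars.

Definition scalars (R : realType) (s : scalar_kind) : numFieldType :=
  match s with RealScalars => R | ComplexScalars => R[i] end.

Definition of_real {R : realType} {s : scalar_kind} : R -> scalars R s :=
  match s with
  | RealScalars => fun x => x
  | ComplexScalars => fun x => real_complex R x
  end.

Definition real_part {R : realType} {s : scalar_kind} : scalars R s -> R :=
  match s with
  | RealScalars => fun x => x
  | ComplexScalars => fun z => complex.Re z
  end.

Definition conj_scalar {R : realType} {s : scalar_kind} :
    scalars R s -> scalars R s :=
  match s with
  | RealScalars => fun x => x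
  | ComplexScalars => fun z => conjc z
  end.

(* The library norm of a normed space over [scalars R s] takes its values in
   [scalars R s]; [rnorm] is the same norm with values in [R]. *)
Definition rnorm {R : realType} {s : scalar_kind}
  {X : normedModType (scalars R s)} (x : X) : R := real_part `|x|.

Section scalars_theory.
Context {R : realType} {s : scalar_kind}.
Implicit Types (x y : R) (z : scalars R s).

Lemma of_realK : cancel (@of_real R s) real_part.
Proof. by case: s. Qed.

Lemma of_realD x y : of_real (x + y) = of_real x + of_real y :> scalars R s.
Proof. by case: s => //=; rewrite rmorphD. Qed.

Lemma of_realM x y : of_real (x * y) = of_real x * of_real y :> scalars R s.
Proof. by case: s => //=; rewrite rmorphM. Qed.

Lemma of_real0 : of_real 0 = 0 :> scalars R s.
Proof. by case: s. Qed.

Lemma ler_of_real x y : (of_real x <= of_real y :> scalars R s) = (x <= y).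
Proof. by case: s => //=; rewrite lecR. Qed.

Lemma of_real_norm (z : scalars R s) : of_real (real_part `|z|) = `|z|.
Proof. by case: s z => //= z; rewrite RRe_real// normr_real. Qed.

Lemma of_real_ge0 (z : scalars R s) : 0 <= z -> of_real (real_part z) = z.
Proof. by move=> z0; rewrite -{1}(ger0_norm z0) of_real_norm ger0_norm. Qed.

Context {X : normedModType (scalars R s)}.
Implicit Types u v : X.

Lemma of_real_rnorm u : of_real (rnorm u) = `|u|.
Proof. by rewrite /rnorm of_real_ge0. Qed.

Lemma rnorm_ge0 u : 0 <= rnorm u.
Proof. by rewrite -(@ler_of_real 0) of_real_rnorm of_real0. Qed.

Lemma ler_rnormD u v : rnorm (u + v) <= rnorm u + rnorm v.
Proof. by rewrite -ler_of_real of_realD !of_real_rnorm ler_normD. Qed.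

Lemma rnormZ (k : scalars R s) u : rnorm (k *: u) = real_part `|k| * rnorm u.
Proof.
apply: (can_inj of_realK).
by rewrite of_realM !of_real_rnorm normrZ of_real_norm.
Qed.

Lemma rnorm0 : rnorm (0 : X) = 0.
Proof. by rewrite /rnorm normr0 -of_real0 of_realK. Qed.

Lemma rnorm0_eq0 u : rnorm u = 0 -> u = 0.
Proof. by move=> u0; apply/normr0_eq0; rewrite -of_real_rnorm u0 of_real0. Qed.

Lemma rnormN u : rnorm (- u) = rnorm u.
Proof. by rewrite /rnorm normrN. Qed.

Lemma ler_dist_rnorm u v : `|rnorm u - rnorm v| <= rnorm (u - v).
Proof.
rewrite ler_norml; apply/andP; split.
  rewrite lerNl opprB lerBlDr -[rnorm (u - v)]rnormN opprB.
  by apply: le_trans (ler_rnormD _ _); rewrite subrK.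
by rewrite lerBlDr; apply: le_trans (ler_rnormD _ _); rewrite subrK.
Qed.

Lemma rnorm_continuous : continuous (@rnorm R s X).
Proof.
move=> u; apply/cvgrPdist_le => /= e e0.
have e0' : 0 < of_real e :> scalars R s.
  by rewrite lt_neqAle -of_real0 ler_of_real (inj_eq (can_inj of_realK))
     -lt_neqAle.
near=> v; apply: le_trans (ler_dist_rnorm _ _) _.
rewrite -ler_of_real of_real_rnorm.
by near: v; apply: cvgr_dist_le => //; exact: cvg_id.
Unshelve. all: by end_near. Qed.

End scalars_theory.

Inductive timeline := HalfLine | WholeLine.

Definition tset {R : realType} (J : timeline) : set R :=
  match J with HalfLine => `[0, +oo[ | WholeLine => setT end.

(* The points of [J] as a type, with the topology induced by [R]. *)
Notation time R J := (set_type (@tset R J)).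

Lemma tset_add {R : realType} (J : timeline) (a b : time R J) :
  set_val a + set_val b \in tset J.
Proof.
case: J a b => -[a a0] [b b0]; rewrite inE//= in_itv/= andbT !set_valE/=.
by move: a0 b0; rewrite !inE /= !in_itv/= !andbT; exact: addr_ge0.
Qed.

Definition tadd {R : realType} {J : timeline} (a b : time R J) : time R J :=
  exist _ (set_val a + set_val b) (tset_add a b).

Lemma tset0 {R : realType} (J : timeline) : (0 : R) \in tset J.
Proof. by case: J; rewrite inE /= ?in_itv/= ?lexx. Qed.

Definition time0 {R : realType} {J : timeline} : time R J :=
  exist _ 0 (tset0 J).

Lemma tadd_continuous {R : realType} {J : timeline} (a : time R J) :
  continuous (tadd a).
Proof.
apply/continuous_comp_initial => b.
have -> : (set_val \o tadd a) = (fun r : R => set_val a + r) \o set_val.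
  by apply/funext => c /=; rewrite !set_valE.
apply: continuous_comp; first exact: initial_continuous.
by apply: cvgD; [exact: cvg_cst|exact: cvg_id].
Qed.


Section bounded_continuous_functions.
Context {R : realType} {s : scalar_kind}.
Variables (J : timeline) (X : normedModType (scalars R s)).

Definition bounded_continuous : {pred time R J -> X} :=
  fun f => `[< continuous f /\ exists M : R, forall t, rnorm (f t) <= M >].

Lemma bounded_continuousP (f : time R J -> X) :
  reflect (continuous f /\ exists M : R, forall t, rnorm (f t) <= M)
          (f \in bounded_continuous).
Proof. exact: asboolP. Qed.

Lemma bounded_continuous_submod : submod_closed bounded_continuous.
Proof.
split=> [|k f g /bounded_continuousP[cf [M Mf]] /bounded_continuousP[cg [N Ng]]].
  apply/bounded_continuousP; split; first exact: cst_continuous.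
  by exists 0 => t; rewrite rnorm0.
apply/bounded_continuousP; split.
  by move=> t; apply: continuousD; [exact/continuousZl_tmp/cf|exact: cg].
exists (real_part `|k| * M + N) => t.
apply: le_trans (ler_rnormD _ _) _; rewrite lerD// rnormZ ler_wpM2l//.
by rewrite -(@ler_of_real R s 0) of_real_norm of_real0.
Qed.

HB.instance Definition _ :=
  GRing.isSubmodClosed.Build (scalars R s) (time R J -> X) bounded_continuous
    bounded_continuous_submod.

Record Cb := MkCb { Cb_fun :> time R J -> X ; _ : Cb_fun \in bounded_continuous }.

HB.instance Definition _ := [isSub for Cb_fun].
HB.instance Definition _ := [Choice of Cb by <:].
HB.instance Definition _ := [SubChoice_isSubLmodule of Cb by <:].

Definition supnorm (f : Cb) : R := sup (range (fun t => rnorm (f t))).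

Lemma Cb_continuous (f : Cb) : continuous f.
Proof. by have /bounded_continuousP[] := valP f. Qed.

Lemma Cb_bounded (f : Cb) : exists M : R, forall t, rnorm (f t) <= M.
Proof. by have /bounded_continuousP[] := valP f. Qed.

Lemma has_sup_Cb (f : Cb) : has_sup (range (fun t => rnorm (f t))).
Proof.
split; first by exists (rnorm (f time0)), time0.
by have [M fM] := Cb_bounded f; exists M => _ [t _ <-].
Qed.

Lemma le_supnorm (f : Cb) t : rnorm (f t) <= supnorm f.
Proof. by apply: ub_le_sup; [case: (has_sup_Cb f)|exists t]. Qed.

Lemma supnorm_le (f : Cb) (M : R) :
  (forall t, rnorm (f t) <= M) -> supnorm f <= M.
Proof.
by move=> fM; apply: ge_sup => [|_ [t _ <-]//]; case: (has_sup_Cb f).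
Qed.

Definition Cb_norm (f : Cb) : scalars R s := of_real (supnorm f).

Lemma ler_Cb_normD f g : Cb_norm (f + g) <= Cb_norm f + Cb_norm g.
Proof.
rewrite /Cb_norm -of_realD ler_of_real; apply: supnorm_le => t.
by apply: le_trans (ler_rnormD _ _) _; rewrite lerD ?le_supnorm.
Qed.

Lemma Cb_normZ k f : Cb_norm (k *: f) = `|k| * Cb_norm f.
Proof.
rewrite /Cb_norm -of_real_norm -of_realM; congr of_real.
have rk : 0 <= real_part `|k|.
  by rewrite -(@ler_of_real R s 0) of_real_norm of_real0.
apply/eqP; rewrite eq_le; apply/andP; split.
  by apply: supnorm_le => t; rewrite rnormZ ler_wpM2l// le_supnorm.
have [k0|k0] := eqVneq (real_part `|k|) 0.
  rewrite k0 mul0r; apply: le_trans (le_supnorm _ time0); exact: rnorm_ge0.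
rewrite mulrC -ler_pdivlMr ?lt_neqAle 1?eq_sym ?k0//.
apply: supnorm_le => t; rewrite ler_pdivlMr ?lt_neqAle 1?eq_sym ?k0//.
by rewrite mulrC -rnormZ (le_supnorm (k *: f)).
Qed.

Lemma Cb_norm0_eq0 f : Cb_norm f = 0 -> f = 0.
Proof.
rewrite /Cb_norm -(@of_real0 R s) => /(can_inj of_realK) f0.
apply/val_inj/funext => t; apply: rnorm0_eq0.
by apply/eqP; rewrite eq_le rnorm_ge0 andbT -f0 le_supnorm.
Qed.

HB.instance Definition _ := Lmodule_isNormed.Build (scalars R s) Cb
  ler_Cb_normD Cb_normZ Cb_norm0_eq0.

End bounded_continuous_functions.

Arguments bounded_continuous {R s} J X.

Section weak_topology.
Context {K : numFieldType}.

Record dual (V : normedModType K) := MkDual {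
  dual_fun :> {linear V -> K^o} ;
  dual_continuous : continuous dual_fun }.

Definition dual_eval (V : normedModType K) (v : V) : {ptws dual V -> K^o} :=
  fun phi => phi v.

Definition weak (V : normedModType K) : topologicalType :=
  initial_topology (@dual_eval V).

End weak_topology.

Section eberlein.
Context {R : realType} {s : scalar_kind}.
Variables (J : timeline) (X : normedModType (scalars R s)).

Lemma translate_subproof (a : time R J) (f : Cb J X) :
  (fun t => f (tadd a t)) \in bounded_continuous J X.
Proof.
apply/bounded_continuousP; split=> [t|].
  by apply: continuous_comp; [exact: tadd_continuous|exact: Cb_continuous].
by have [M fM] := Cb_bounded f; exists M.
Qed.

Definition translate (a : time R J) (f : Cb J X) : Cb J X :=
  MkCb (translate_subproof a f).

Definition translation_orbit (f : Cb J X) : set (Cb J X) := range (translate ^~ f).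

Definition EAP : set (Cb J X) :=
  [set f | precompact (translation_orbit f : set (weak (Cb J X)))].

Definition EAP0 : set (Cb J X) :=
  [set f | EAP f /\ closure (translation_orbit f : set (weak (Cb J X))) (0 : Cb J X)].

End eberlein.

Section means.
Context {R : realType} {s : scalar_kind} {X : normedModType (scalars R s)}.

(* The Riemann integral of [g] over [a, b], as the limit of the Riemann sums
   over tagged partitions [x 0 <= ... <= x n] as the mesh goes to 0. *)
Definition is_riemann_integral (g : R -> X) (a b : R) (I : X) : Prop :=
  forall e : R, 0 < e -> exists2 d : R, 0 < d &
    forall (n : nat) (x xi : nat -> R), x 0%N = a -> x n = b ->
      (forall i, (i < n)%N ->
         x i <= xi i <= x i.+1 /\ x i.+1 - x i < d) ->
      rnorm (\sum_(i < n) of_real (x i.+1 - x i) *: g (xi i) - I) < e.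

(* [m] is the mean of [g]; [valL_ 0 g] extends [g] by 0 outside [J] and is
   integrated inside [J] only. *)
Definition is_mean (J : timeline) (g : time R J -> X) (m : X) : Prop :=
  exists2 I : R -> X,
    forall T : R, 0 < T -> is_riemann_integral ('valL_0 g)
      (match J with HalfLine => 0 | WholeLine => - T end) T (I T)
  & of_real (match J with HalfLine => T^-1 | WholeLine => (2 * T)^-1 end)
      *: I T @[T --> +oo] --> m.

End means.

Section almost_periodic.
Context {R : realType} {s : scalar_kind} {X : normedModType (scalars R s)}.

Definition bohr_almost_periodic (g : R -> X) : Prop :=
  continuous g /\
  forall e : R, 0 < e -> exists2 L : R, 0 < L & forall a : R,
    exists2 tau : R, a <= tau <= a + L &
      forall t : R, rnorm (g (t + tau) - g t) <= e.

Definition AP (J : timeline) : set (time R J -> X) :=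
  [set f | exists2 g : R -> X, bohr_almost_periodic g & f = sigL (tset J) g].

End almost_periodic.

Section absolute_value.
Context {R : realType} {s : scalar_kind} {J : timeline}.
Context {X : normedModType (scalars R s)}.

Lemma rnorm_scalar (x : R) : @rnorm R RealScalars R^o x = `|x|.
Proof. by []. Qed.

Lemma absf_subproof (f : Cb J X) :
  (fun t => rnorm (f t)) \in @bounded_continuous R RealScalars J R^o.
Proof.
apply/bounded_continuousP; split=> [t|].
  apply: (@continuous_comp _ _ _ f rnorm); first exact: Cb_continuous.
  exact: rnorm_continuous.
have [M fM] := Cb_bounded f; exists M => t.
by rewrite rnorm_scalar ger0_norm ?rnorm_ge0.
Qed.

Definition absf (f : Cb J X) : @Cb R RealScalars J R^o :=
  MkCb (absf_subproof f).

Lemma absf2_subproof (f : Cb J X) :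
  (fun t => rnorm (f t) ^+ 2) \in @bounded_continuous R RealScalars J R^o.
Proof.
apply/bounded_continuousP; split=> [t|].
  apply: (@continuous_comp _ _ _ (absf f) (fun x : R => x ^+ 2)).
    exact: Cb_continuous.
  exact: exprn_continuous.
have [M fM] := Cb_bounded f; exists (M ^+ 2) => t.
rewrite rnorm_scalar ger0_norm ?exprn_ge0 ?rnorm_ge0//.
by rewrite lerXn2r ?nnegrE ?rnorm_ge0// (le_trans (rnorm_ge0 (f t))).
Qed.

Definition absf2 (f : Cb J X) : @Cb R RealScalars J R^o :=
  MkCb (absf2_subproof f).

Definition PAP0 : set (Cb J X) :=
  [set f | @is_mean R RealScalars R^o J (absf f) 0].

Definition PAP : set (Cb J X) :=
  [set f | exists g : time R J -> X, exists h : Cb J X,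
     [/\ AP g, PAP0 h & forall t, f t = g t + h t]].

End absolute_value.

Section fourier.
Context {R : realType}.

(* The complexification of a real [H] is [H * H], where [(x, y)] stands for
   [x + i y]. The max norm which the library puts on [H * H] induces the
   topology of the Hilbert norm, and only its topology is used (to take means);
   the Hilbert norm is [cplx_norm2] below. A complex [H] is left unchanged. *)
Definition complexification (s : scalar_kind) :
    normedModType (scalars R s) -> normedModType (scalars R s) :=
  match s with
  | RealScalars => fun H => (H * H)%type : normedModType R
  | ComplexScalars => fun H => H
  end.

(* The vector [e^{-i theta} x] of the complexification. *)
Definition rotate (s : scalar_kind) (theta : R) :
    forall H : normedModType (scalars R s), H -> complexification H :=
  match s with
  | RealScalars => fun H (x : (H : normedModType R)) =>
      (cos theta *: x, - sin theta *: x)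
  | ComplexScalars => fun H (x : (H : normedModType R[i])) =>
      ((cos theta) -i* (sin theta))%C *: x
  end.

Definition cplx_norm2 (s : scalar_kind) :
    forall H : normedModType (scalars R s), complexification H -> R :=
  match s with
  | RealScalars => fun H (z : ((H : normedModType R) * H)%type) =>
      @rnorm R RealScalars H z.1 ^+ 2 + @rnorm R RealScalars H z.2 ^+ 2
  | ComplexScalars => fun H z => @rnorm R ComplexScalars H z ^+ 2
  end.

Context {s : scalar_kind} {J : timeline} {H : normedModType (scalars R s)}.

Definition is_fourier_coefficient (f : Cb J H) (lambda : R)
    (c : complexification H) : Prop :=
  is_mean (fun t : time R J => rotate (lambda * set_val t) (f t)) c.

Definition parseval (f : Cb J H) : Prop :=
  exists (m : R) (c : R -> complexification H),
    [/\ @is_mean R RealScalars R^o J (absf2 f) m,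
        forall lambda, is_fourier_coefficient f lambda (c lambda)
      & m%:E = \esum_(lambda in [set: R]) (cplx_norm2 (c lambda))%:E].

End fourier.

Section hilbert.
Context {R : realType} {s : scalar_kind}.

Definition is_hilbert (H : completeNormedModType (scalars R s)) : Prop :=
  exists ip : {dot H for @conj_scalar R s}, forall x : H, `|x| ^+ 2 = ip x x.

Definition separable (T : topologicalType) : Prop :=
  exists2 D : set T, countable D & dense D.

Definition finite_dimensional (K : numFieldType) (V : lmodType K) : Prop :=
  exists (n : nat) (e : 'I_n -> V),
    forall v : V, exists a : 'I_n -> K, v = \sum_(i < n) a i *: e i.

End hilbert.

(* Main.v *)
Require Import Defs.
From HB Require Import structures.
From mathcomp Require Import all_boot all_order all_algebra.
From mathcomp Require Import all_classical all_reals all_analysis.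
From mathcomp Require Import sesquilinear complex ring lra.

Set Implicit Arguments.
Unset Strict Implicit.
Unset Printing Implicit Defensive.

Import Order.TTheory GRing.Theory Num.Theory.
Import numFieldNormedType.Exports.

Local Open Scope classical_set_scope.
Local Open Scope ring_scope.

(* Let p t = 1 - cos (2 pi t) and let (e_n), n an integer, be an orthonormal
   family. The function f t = p t *: e_(floor t) is a hump of constant shape
   which moves to a fresh orthogonal direction at every integer.
   Since p vanishes at the integers, f is Lipschitz, and |f| = p is periodic.
   Translates of f by times at mutual distance >= 1 are pointwise orthogonal, so
   a sum of n of them with unimodular coefficients has norm at most 2 sqrt n.
   A continuous functional phi of norm C with |phi f_s| >= eps on n such times
   thus gives n eps <= 2 C sqrt n, which bounds n: f_s tends weakly to 0 as |s|
   tends to infinity, and the orbit together with 0 is weakly compact.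
   Orthogonality also makes the integral of e^(-i lambda t) f t over a window of
   length T of order sqrt T, so all Fourier coefficients vanish while |f|^2 has
   mean 3/2. If f = g + h with g almost periodic and |h| of mean 0, an almost
   period tau >= 1 of g forces p t <= |h t| + |h (t + tau)| + eps, which
   contradicts the mean 1 of p. *)

(** * Scalars, norms and orthonormal sequences *)

Section rnorm_extra.
Context {R : realType} {s : scalar_kind}.
Local Notation K := (scalars R s).

Lemma of_real1 : of_real 1 = 1 :> K.
Proof. by case: s. Qed.

Lemma of_realN (x : R) : of_real (- x) = - of_real x :> K.
Proof. by case: s => //=; rewrite rmorphN. Qed.

Lemma ltr_of_real (x y : R) : (of_real x < of_real y :> K) = (x < y).
Proof.
by rewrite !lt_neqAle ler_of_real (inj_eq (can_inj of_realK)).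
Qed.

Lemma normr_of_real (x : R) : `|of_real x : K| = of_real `|x|.
Proof. by case: s => //=; rewrite normc_def/= expr0n/= addr0 sqrtr_sqr. Qed.

Lemma of_realX (x : R) n : of_real (x ^+ n) = of_real x ^+ n :> K.
Proof. by elim: n => [|n IH]; rewrite ?expr0 ?of_real1// !exprS of_realM IH. Qed.

Lemma conj_scalarM_norm (z : K) : z * conj_scalar z = `|z| ^+ 2.
Proof.
case: s z => /= z; first by rewrite real_normK ?num_real// expr2.
by rewrite sqr_normc.
Qed.

Lemma of_realV (x : R) : of_real x^-1 = (of_real x)^-1 :> K.
Proof. by case: s => //=; rewrite fmorphV. Qed.

Lemma conj_scalarM_of_real (z : K) (x : R) :
  conj_scalar (z * of_real x) = conj_scalar z * of_real x.
Proof. case: s z => //= z; rewrite rmorphM; congr (_ * _); exact: conjc_real. Qed.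

Context {X : normedModType K}.
Implicit Types u v : X.

Lemma rnormZ_of_real (x : R) u : rnorm (of_real x *: u) = `|x| * rnorm u.
Proof. by rewrite rnormZ normr_of_real of_realK. Qed.

Lemma rnorm_distC u v : rnorm (u - v) = rnorm (v - u).
Proof. by rewrite -rnormN opprB. Qed.

(** Even over complex scalars a positive element is the image of a positive real, so limits can be
    checked with real tolerances. *)
Lemma rnorm_cvgP (T : Type) (F : set_system T) (FF : Filter F) (f : T -> X)
    (l : X) :
  f @ F --> l <-> forall e : R, 0 < e -> \forall x \near F, rnorm (l - f x) <= e.
Proof.
split=> [/cvgrPdist_le fl e e0|fl].
  have /fl : 0 < of_real e :> K by rewrite -of_real0 ltr_of_real.
  by apply: filterS => x; rewrite -of_real_rnorm ler_of_real.
apply/cvgrPdist_le => e e0.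
have [r eE] : exists r : R, e = of_real r.
  by exists (real_part e); rewrite of_real_ge0 ?ltW.
move: e0; rewrite {}eE -of_real0 ltr_of_real => /fl.
by apply: filterS => x; rewrite -of_real_rnorm ler_of_real.
Qed.

Lemma rnorm_lipschitz_continuous (f : R -> X) (k : R) :
  (forall x y, rnorm (f x - f y) <= k * `|x - y|) -> continuous f.
Proof.
move=> fk x; apply/rnorm_cvgP => e e0.
have k0 : 0 < `|k| + 1 by rewrite ltr_wpDl.
have /cvgrPdist_le/(_ _ (divr_gt0 e0 k0)) : y @[y --> x] --> x by exact: cvg_id.
apply: filterS => y; rewrite ler_pdivlMr// => xy.
apply: le_trans (fk _ _) _; apply: le_trans xy; rewrite mulrC ler_wpM2l//.
by rewrite (le_trans (ler_norm _))// lerDl.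
Qed.

End rnorm_extra.

Section hilbert_geometry.
Context {R : realType} {s : scalar_kind} {H : completeNormedModType (scalars R s)}.
Local Notation K := (scalars R s).
Variable ip : {dot H for @conj_scalar R s}.
Hypothesis ipE : forall x : H, `|x| ^+ 2 = ip x x.
Implicit Types x y z : H.

Lemma ipC x y : ip x y = conj_scalar (ip y x).
Proof. by rewrite [LHS]hermitian_subproof expr0 mul1r. Qed.

Lemma ipDl x y z : ip (x + y) z = ip x z + ip y z.
Proof.
have b : zmod_morphism (ip ^~ z) by exact: zmod_morphisml_subproof.
have N u : ip (- u) z = - ip u z.
  by rewrite -[- u]sub0r b -(subrr u) b subrr sub0r.
by rewrite -{1}(opprK y) b N opprK.
Qed.

Lemma ipZl (k : K) x z : ip (k *: x) z = k * ip x z.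
Proof. exact: linearl_subproof. Qed.

Lemma ip0l z : ip 0 z = 0.
Proof. by rewrite -(scale0r 0) ipZl mul0r. Qed.

Lemma conj_scalar0 : conj_scalar 0 = 0 :> K.
Proof. by case: s => //=; exact: conjc0. Qed.

Lemma ip_eq0C x y : ip x y = 0 -> ip y x = 0.
Proof. by rewrite [ip y x]ipC => ->; exact: conj_scalar0. Qed.

Lemma ipBl x y z : ip (x - y) z = ip x z - ip y z.
Proof. exact: zmod_morphisml_subproof. Qed.

Lemma ipBr x y z : ip x (y - z) = ip x y - ip x z.
Proof. exact: zmod_morphismr_subproof. Qed.

Lemma ipDr x y z : ip x (y + z) = ip x y + ip x z.
Proof.
have N u : ip x (- u) = - ip x u.
  by rewrite -[- u]sub0r ipBr -(subrr u) ipBr subrr sub0r.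
by rewrite -{1}(opprK z) ipBr N opprK.
Qed.

Lemma ipZr (k : K) x y : ip x (k *: y) = conj_scalar k * ip x y.
Proof. exact: linearr_subproof. Qed.

Lemma ip_suml n (v : 'I_n -> H) z : ip (\sum_(i < n) v i) z = \sum_(i < n) ip (v i) z.
Proof.
elim: n v => [|n IH] v; first by rewrite !big_ord0 ip0l.
by rewrite !big_ord_recr/= ipDl IH.
Qed.

Lemma rnorm_sqrE x : of_real (rnorm x ^+ 2) = ip x x.
Proof. by rewrite of_realX of_real_rnorm ipE. Qed.

Lemma rnorm_sqrD x y : ip x y = 0 -> rnorm (x + y) ^+ 2 = rnorm x ^+ 2 + rnorm y ^+ 2.
Proof.
move=> xy; apply: (can_inj (@of_realK R s)).
by rewrite of_realD !rnorm_sqrE ipDl !ipDr xy (ip_eq0C xy) addr0 add0r.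
Qed.

Lemma pythagoras n (v : nat -> H) :
  (forall i j, (i < n)%N -> (j < n)%N -> i != j -> ip (v i) (v j) = 0) ->
  rnorm (\sum_(i < n) v i) ^+ 2 = \sum_(i < n) rnorm (v i) ^+ 2.
Proof.
elim: n => [|n IH] vo; first by rewrite !big_ord0 rnorm0 expr0n.
rewrite !big_ord_recr/= -IH => [|i j ilt jlt]; last by apply: vo; exact: ltnW.
rewrite rnorm_sqrD// ip_suml big1// => i _.
by apply: vo => //; [rewrite ltnS ltnW|rewrite neq_ltn ltn_ord].
Qed.

(** Cauchy-Schwarz: the residual of [x] after projection onto the line of [y] has a nonnegative
    squared norm. *)
Lemma ler_norm_ip x y : `|ip x y| <= `|x| * `|y|.
Proof.
have [->|y0] := eqVneq y 0; first by rewrite -(scale0r 0) ipZr conj_scalar0 mul0r normr0 mulr_ge0.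
have Y0 : 0 < `|y| ^+ 2 by rewrite exprn_gt0// normr_gt0.
rewrite -ler_sqr ?nnegrE ?mulr_ge0// exprMn -ler_pdivrMr//.
set a := ip x y; rewrite -subr_ge0.
suff <- : `|x - (a / `|y| ^+ 2) *: y| ^+ 2 = `|x| ^+ 2 - `|a| ^+ 2 / `|y| ^+ 2.
  by rewrite exprn_ge0.
rewrite !ipE ipBl !ipBr !ipZl !ipZr -!ipE (ipC y x) -/a.
have -> : conj_scalar (a / `|y| ^+ 2) = conj_scalar a / `|y| ^+ 2.
  by rewrite -(of_real_rnorm y) -of_realX -of_realV conj_scalarM_of_real.
rewrite -conj_scalarM_norm divfK ?lt0r_neq0// subrr subr0.
by rewrite mulrAC [conj_scalar a * a]mulrC.
Qed.

(** One Gram-Schmidt step: in infinite dimension some [v] lies outside the span of the first [n]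
    vectors, and its residual can be normalised. *)
Lemma exists_orthogonal_unit : ~ finite_dimensional H ->
  forall n (e : nat -> H),
  (forall i j, (i < n)%N -> (j < n)%N -> ip (e i) (e j) = (i == j)%:R) ->
  exists x : H, `|x| = 1 /\ forall i, (i < n)%N -> ip x (e i) = 0.
Proof.
move=> infH n e eo.
have /existsNP[v vN] : ~ forall v : H, exists a : 'I_n -> K,
    v = \sum_(i < n) a i *: e i.
  by move=> fin; apply: infH; exists n, (fun i => e i).
pose y := v - \sum_(i < n) ip v (e i) *: e i.
have y0 : y != 0.
  apply/eqP => /eqP; rewrite subr_eq0 => /eqP yE.
  by apply: vN; exists (fun i => ip v (e i)).
exists (`|y|^-1 *: y); split.
  by rewrite normrZ normfV normr_id mulVf// normr_eq0.
move=> i ilt; rewrite ipZl ipBl ip_suml (bigD1 (Ordinal ilt))//= big1.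
  by rewrite ipZl eo// eqxx mulr1 addr0 subrr mulr0.
by move=> j ji; rewrite ipZl eo//; have -> : (j == i :> nat) = false;
  [exact/negbTE|rewrite mulr0].
Qed.

Lemma exists_orthonormal_sequence : ~ finite_dimensional H ->
  exists e : nat -> H, forall i j, ip (e i) (e j) = (i == j)%:R.
Proof.
move=> infH.
(* [nx] proposes the next vector from the list of its predecessors; lists that are not orthonormal
   get the dummy value 0. *)
have /choice[nx nxP] : forall l : seq H, exists x : H,
    (forall i j, (i < size l)%N -> (j < size l)%N ->
       ip (nth 0 l i) (nth 0 l j) = (i == j)%:R) ->
    `|x| = 1 /\ forall i, (i < size l)%N -> ip x (nth 0 l i) = 0.
  move=> l; have [h|h] := pselect (forall i j, (i < size l)%N -> (j < size l)%N ->
       ip (nth 0 l i) (nth 0 l j) = (i == j)%:R); last by exists 0.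
  by have [x xP] := exists_orthogonal_unit infH h; exists x.
pose L := fix L n := if n is m.+1 then rcons (L m) (nx (L m)) else [::].
pose e n := nx (L n).
have LE n : L n = mkseq e n.
  by elim: n => //= n IH; rewrite mkseqS -IH.
exists e.
suff eo n i j : (i < n)%N -> (j < n)%N -> ip (e i) (e j) = (i == j)%:R.
  by move=> i j; apply: (eo (maxn i j).+1); rewrite ltnS ?leq_maxl ?leq_maxr.
elim: n i j => // n IH.
have [n1 no] : `|e n| = 1 /\ forall i, (i < n)%N -> ip (e n) (e i) = 0.
  have enE : e n = nx (mkseq e n) by rewrite -LE.
  have := nxP (mkseq e n); rewrite size_mkseq -enE => -[|-> eno].
    by move=> i j il jl; rewrite !nth_mkseq//; exact: IH.
  by split=> // i ilt; rewrite -(eno _ ilt) nth_mkseq.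
move=> i j; rewrite ltnS leq_eqVlt => /predU1P[->|ilt];
  rewrite ltnS leq_eqVlt => /predU1P[->|jlt].
- by rewrite eqxx -ipE n1 expr1n.
- by rewrite no// gtn_eqF.
- by rewrite ip_eq0C ?no// ltn_eqF.
- exact: IH.
Qed.

End hilbert_geometry.

(** * Weak topology of the space of bounded continuous functions *)

(** An ultrafilter on [A] either converges to [x] or misses a neighbourhood [U] of [x]; in the
    second case it lives on the compact set [C]. The application is to an orbit completed by its
    weak limit 0. *)
Lemma compact_cocompact_nbhs (T : topologicalType) (A : set T) (x : T) :
  A x ->
  (forall U, nbhs x U -> exists2 C, compact C & C `<=` A /\ A `<=` U `|` C) ->
  compact A.
Proof.
move=> Ax AU; rewrite compact_ultra => F UF FA.
have [Fx|/existsNP[U /not_implyP[xU FU]]] := pselect (F --> x).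
  by exists x.
have [C + [CA AUC]] := AU _ xU; rewrite compact_ultra => /(_ F UF)[|y [Cy Fy]].
  have [//|FU'] := in_ultra_setVsetC U UF.
  apply: filterS (filterI FA FU') => y [Ay Uy].
  by have [] := AUC _ Ay.
by exists y; split => //; exact: CA.
Qed.

Lemma initial_cvg (S : choiceType) (T : topologicalType) (g : S -> T)
    (F : set_system S) (x : S) : Filter F ->
  g @ F --> g x <-> F --> (x : initial_topology g).
Proof.
move=> FF; split=> [gF A /= [_ [[B oB <-] Bx BA]]|Fx].
  have /gF : nbhs (g x) B by rewrite nbhsE; exists B.
  exact: (@filterS _ F FF (g @^-1` B) A BA).
by move=> A /(@initial_continuous _ _ g x); exact: Fx.
Qed.

Lemma ptws_cvgP (U : Type) (V : topologicalType) (F : set_system (U -> V))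
    (f : U -> V) : Filter F ->
  {ptws, F --> f} <-> forall t, g t @[g --> F] --> f t.
Proof.
move=> FF; split=> [/cvg_sup Ff t|Ff].
  by apply/(@initial_cvg _ _ (fun g : U -> V => g t)); exact: Ff.
by apply/cvg_sup => t; apply/initial_cvg; exact: Ff.
Qed.

Section weak_topology_theory.
Context {K : numFieldType} {V : normedModType K}.

Lemma weak_cvg (F : set_system V) (x : V) : Filter F ->
  (forall phi : dual V, phi y @[y --> F] --> (phi x : K^o)) ->
  (F : set_system (weak V)) --> (x : weak V).
Proof.
move=> FF Fx; apply/(@initial_cvg _ _ (@dual_eval K V) F x FF).
by apply/ptws_cvgP => phi; exact: Fx.
Qed.

Lemma dual_weak_continuous (phi : dual V) :
  continuous (phi : weak V -> K^o).
Proof.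
move=> x.
have /ptws_cvgP/(_ phi) :
    {ptws, (@dual_eval K V) @ nbhs (x : weak V) --> dual_eval x}.
  exact: initial_continuous.
exact.
Qed.

(** In a Hausdorff space compact sets are closed; this is how a compact set containing an orbit
    makes the orbit [precompact]. *)
Lemma weak_hausdorff :
  (forall x y : V, x <> y -> exists phi : dual V, phi x <> phi y) ->
  hausdorff_space (weak V).
Proof.
move=> sep p q pq; apply: contrapT => /sep[phi]; apply.
apply: (@norm_hausdorff K K^o) => A B Ap Bq.
have [y [yA yB]] := pq _ _ (dual_weak_continuous Ap) (dual_weak_continuous Bq).
by exists (phi y).
Qed.

Lemma dual_of_bounded (g : V -> K^o) (M : K) : 0 <= M -> linear g ->
  (forall v, `|g v| <= M * `|v|) -> exists phi : dual V, forall v, phi v = g v.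
Proof.
move=> M0 lin gM.
pose gl : {linear V -> K^o} := HB.pack g (GRing.isLinear.Build K V K^o *:%R g lin).
suff cg : continuous gl by exists (MkDual cg).
have M10 : 0 < M + 1 by rewrite ltr_wpDl.
move=> x; apply/cvgrPdist_le => e e0.
have /cvgrPdist_le/(_ _ (divr_gt0 e0 M10)) : y @[y --> x] --> x by exact: cvg_id.
apply: filterS => y; rewrite ler_pdivlMr// => xy.
rewrite -linearB; apply: le_trans (gM _) _; apply: le_trans xy.
by rewrite mulrC ler_wpM2l// lerDl.
Qed.

Lemma dual_bounded (phi : dual V) :
  exists2 M : K, 0 < M & forall v, `|phi v| <= M * `|v|.
Proof.
have /linear_boundedP/pinfty_ex_gt0[M M0 phiM] : bounded_near phi (nbhs (0 : V)).
  exact/linear_bounded_continuous/dual_continuous.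
by exists M.
Qed.

End weak_topology_theory.

(** * Weak compactness of the translates over a bounded range of times *)

Section orbits.
Context {R : realType} {s : scalar_kind} {J : timeline}.
Context {X : normedModType (scalars R s)}.
Local Notation K := (scalars R s).

Lemma set_val_tadd (a b : time R J) : set_val (tadd a b) = set_val a + set_val b.
Proof. exact: (congr1 (fun g => g (tadd a b)) set_valE). Qed.

Lemma tproj_subproof (r : R) :
  match J with HalfLine => Num.max r 0 | WholeLine => r end \in tset J.
Proof. by case: J; rewrite inE//= in_itv/= andbT le_max lexx orbT. Qed.

(** This 1-Lipschitz retraction of the line onto J lets translates be indexed by real numbers, whose
    segments are compact. *)
Definition tproj (r : R) : time R J := exist (fun x => x \in tset J) _ (tproj_subproof r).

Lemma set_val_tproj (r : R) : tset J r -> set_val (tproj r) = r.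
Proof.
rewrite /tproj set_valE/=; case: J => //=.
by rewrite in_itv/= andbT => r0; rewrite max_l.
Qed.

Lemma tproj_set_val (t : time R J) : tproj (set_val t) = t.
Proof. by apply: val_inj; exact: set_val_tproj (set_valP t). Qed.

Lemma ler_dist_tproj (a b : R) : `|set_val (tproj a) - set_val (tproj b)| <= `|a - b|.
Proof.
rewrite /tproj !set_valE/=; case: J => //.
have := ler_norm (a - b); have := ler_norm (b - a); rewrite (distrC b a) ler_norml.
by case: (leP a 0) => a0; case: (leP b 0) => b0 ? ?; apply/andP; split; lra.
Qed.

Lemma tproj_continuous : continuous tproj.
Proof.
apply: continuous_comp_initial => r.
have := @rnorm_lipschitz_continuous R RealScalars R^o (set_val \o tproj) 1.
apply => a b; rewrite mul1r; exact: ler_dist_tproj.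
Qed.

Lemma rnorm_CbE (f : Cb J X) : rnorm f = supnorm f.
Proof. exact: of_realK. Qed.

(** Shifting two times by the same [t] keeps their difference, so the Lipschitz bound on [f] is
    uniform in [t] and passes to the sup norm. *)
Lemma translate_continuous (f : Cb J X) (k : R) : 0 <= k ->
  (forall t u, rnorm (f t - f u) <= k * `|set_val t - set_val u|) ->
  continuous (fun r => translate (tproj r) f).
Proof.
move=> k0 fk; apply: (@rnorm_lipschitz_continuous _ _ _ _ k) => a b.
rewrite rnorm_CbE; apply: supnorm_le => t.
apply: le_trans (fk (tadd (tproj a) t) (tadd (tproj b) t)) _.
rewrite ler_wpM2l// !set_val_tadd opprD addrACA subrr addr0.
exact: ler_dist_tproj.
Qed.

Lemma norm_weak_continuous (V : normedModType K) (T : topologicalType) (g : T -> V) :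
  continuous g -> continuous (g : T -> weak V).
Proof.
move=> cg x; apply: weak_cvg => phi.
by apply: (@continuous_comp _ _ _ g phi); [exact: cg|exact: dual_continuous].
Qed.

Lemma compact_translates (f : Cb J X) (k : R) (a b : R) : 0 <= k ->
  (forall t u, rnorm (f t - f u) <= k * `|set_val t - set_val u|) ->
  compact ((fun r => translate (tproj r) f) @` `[a, b] : set (weak (Cb J X))).
Proof.
move=> k0 fk; apply: continuous_compact; last exact: segment_compact.
by apply: continuous_subspaceT; apply: norm_weak_continuous; exact: translate_continuous fk.
Qed.

End orbits.

Section weak_Cb_hausdorff.
Context {R : realType} {J : timeline}.

(** Evaluation at a point where [f] and [g] differ, followed by a functional of [X] that separates
    the two values, is a bounded functional on [Cb J X]. *)
Lemma weak_Cb_hausdorff (s : scalar_kind) (X : normedModType (scalars R s)) :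
  (forall x : X, x <> 0 -> exists phi : dual X, phi x <> 0) ->
  hausdorff_space (weak (Cb J X)).
Proof.
move=> sep; apply: weak_hausdorff => f g fg.
have [t /eqP] : exists t, f t <> g t.
  by apply/existsNP => fgE; apply: fg; apply/val_inj/funext.
rewrite -subr_eq0 => /eqP/sep[phi phit].
have [M M0 phiM] := dual_bounded phi.
have [psi psiE] : exists psi : dual (Cb J X), forall h, psi h = phi (h t).
  apply: (@dual_of_bounded _ _ _ M (ltW M0)) => [a u v|v]; first by rewrite -linearP.
  apply: le_trans (phiM _) _; rewrite (ler_wpM2l (ltW M0))//.
  by rewrite -(of_real_rnorm (v t)) -[`|v|]of_real_rnorm ler_of_real rnorm_CbE le_supnorm.
exists psi; rewrite !psiE => /eqP; rewrite -subr_eq0 -linearB => /eqP.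
exact: phit.
Qed.

Lemma weak_Cb_R_hausdorff :
  hausdorff_space (weak (@Cb R RealScalars J R^o)).
Proof.
apply: weak_Cb_hausdorff => x x0.
have [phi phiE] : exists phi : dual (R^o : normedModType R), forall v, phi v = v.
  apply: (@dual_of_bounded _ _ _ 1 ler01) => [//|v]; by rewrite mul1r.
by exists phi; rewrite phiE.
Qed.

Lemma weak_Cb_hilbert_hausdorff (s : scalar_kind)
    (H : completeNormedModType (scalars R s)) :
  is_hilbert H -> hausdorff_space (weak (Cb J H)).
Proof.
move=> [ip ipE]; apply: weak_Cb_hausdorff => x x0.
(* The Riesz functional of [x] is bounded by Cauchy-Schwarz and takes the value |x|^2 at [x]. *)
have [phi phiE] : exists phi : dual H, forall v, phi v = ip v x.
  apply: (@dual_of_bounded _ _ _ `|x| (normr_ge0 _)) => [a u v|v].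
    by rewrite ipDl ipZl.
  by rewrite mulrC; exact: ler_norm_ip.
exists phi; rewrite phiE -ipE => /eqP; rewrite expf_eq0/= normr_eq0 => /eqP.
exact: x0.
Qed.

End weak_Cb_hausdorff.

(** * Riemann integrals and means *)

Section antiderivatives.
Context {R : realType}.
Implicit Types (g G : R -> R) (a b x y : R).

Lemma exists_antiderivative g a b : continuous g ->
  exists G, forall x, a <= x <= b -> is_derive x 1 G (g x).
Proof.
move=> cg.
(* Starting the integral at [a - 1] makes [a] an interior point, so that the derivative there is
   two-sided; [b + 1] does the same on the right. *)
exists (fun x => (\int[lebesgue_measure]_(t in `[(a - 1), x]) g t)%R).
move=> x /andP[ax xb].
have xb1 : x < b + 1 by lra.
have ax1 : a - 1 < x by lra.
have ig : lebesgue_measure.-integrable `[a - 1, b + 1] (EFin \o g).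
  apply: continuous_compact_integrable; first exact: segment_compact.
  exact: continuous_subspaceT.
have [dG <-] := continuous_FTC1_closed xb1 ig ax1 (cg x).
by rewrite derive1E; exact: derivableP.
Qed.

Lemma mean_value g G a b : (forall x, a <= x <= b -> is_derive x 1 G (g x)) ->
  forall x y, a <= x -> x <= y -> y <= b ->
  exists2 c, x <= c <= y & G y - G x = g c * (y - x).
Proof.
move=> dG x y ax xy yb.
have [] := @MVT_segment R G g x y xy.
- move=> z; rewrite in_itv/= => /andP[xz zy]; apply: dG.
  by rewrite (le_trans ax (ltW xz)) (le_trans (ltW zy) yb).
- apply: derivable_within_continuous => z; rewrite in_itv/= => /andP[xz zy].
  have /dG dz : a <= z <= b by rewrite (le_trans ax xz) (le_trans zy yb).
  exact: ex_derive.
- by move=> c; rewrite in_itv/=; exists c.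
Qed.

End antiderivatives.

Section riemann_integral.
Context {R : realType} {s : scalar_kind} {X : normedModType (scalars R s)}.
Implicit Types (g h : R -> X) (a b : R).

Lemma exists_partition a b (d : R) : a <= b -> 0 < d ->
  exists (n : nat) (x : nat -> R), [/\ x 0%N = a, x n = b &
    forall i, (i < n)%N -> x i <= x i.+1 /\ x i.+1 - x i < d].
Proof.
move=> ab d0.
pose n := (Num.truncn ((b - a) / d)).+1.
have n0 : 0 < n%:R :> R by rewrite ltr0n.
have step : (b - a) / n%:R < d.
  rewrite ltr_pdivrMr// mulrC -ltr_pdivrMr//; exact: truncnS_gt.
exists n, (fun i => a + i%:R * ((b - a) / n%:R)); split.
- by rewrite mul0r addr0.
- by rewrite mulrC divfK ?gt_eqF// addrC subrK.
- move=> i _; have E : a + i.+1%:R * ((b - a) / n%:R) - (a + i%:R * ((b - a) / n%:R))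
      = (b - a) / n%:R by rewrite -natr1; ring.
  by split; [rewrite -subr_ge0 E divr_ge0// ?subr_ge0// ltW|rewrite E].
Qed.

Lemma partition_mem (n : nat) (x xi : nat -> R) (d : R) :
  (forall i, (i < n)%N -> x i <= xi i <= x i.+1 /\ x i.+1 - x i < d) ->
  forall i, (i < n)%N -> x 0%N <= xi i <= x n.
Proof.
move=> xP.
have x0 i : (i <= n)%N -> x 0%N <= x i.
  elim: i => // i IH ilt; apply: le_trans (IH (ltnW ilt)) _.
  by have [/andP[h1 h2] _] := xP _ ilt; exact: le_trans h1 h2.
have xn k : (k <= n)%N -> x (n - k)%N <= x n.
  elim: k => [|k IH klt]; first by rewrite subn0.
  apply: le_trans (IH (ltnW klt)).
  have lt : (n - k.+1 < n)%N by rewrite ltn_subrL (leq_ltn_trans _ klt).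
  have [/andP[h1 h2] _] := xP _ lt; apply: le_trans h1 _.
  by rewrite -subSn// subSS in h2.
move=> i ilt; have [/andP[h1 h2] _] := xP _ ilt; apply/andP; split.
  exact: le_trans (x0 _ (ltnW ilt)) h1.
apply: le_trans h2 _; rewrite -(subKn ilt); exact/xn/leq_subr.
Qed.

Lemma is_riemann_integral_ext g h a b I :
  (forall t, a <= t <= b -> g t = h t) ->
  is_riemann_integral g a b I -> is_riemann_integral h a b I.
Proof.
move=> gh gI e e0; have [d d0 dP] := gI e e0; exists d => // n x xi xa xb xP.
have -> : \sum_(i < n) of_real (x i.+1 - x i) *: h (xi i) =
          \sum_(i < n) of_real (x i.+1 - x i) *: g (xi i); last exact: dP.
apply: eq_bigr => i _; rewrite gh// -xa -xb.
exact: partition_mem xP _ (ltn_ord i).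
Qed.

(** Both integrals are compared with a single Riemann sum, whose partition is finer than both meshes
    and is tagged at left end points. *)
Lemma is_riemann_integral_unique g a b I I' : a <= b ->
  is_riemann_integral g a b I -> is_riemann_integral g a b I' -> I = I'.
Proof.
move=> ab gI gI'; apply/eqP; rewrite -subr_eq0; apply/eqP/rnorm0_eq0/eqP.
rewrite eq_le rnorm_ge0 andbT; apply/ler_addgt0Pr => e e0; rewrite add0r.
have e20 : 0 < e / 2 by rewrite divr_gt0.
have [d d0 dP] := gI _ e20; have [d' d'0 d'P] := gI' _ e20.
have [|n [x [xa xb xP]]] := @exists_partition a b (Num.min d d') ab.
  by rewrite lt_min d0.
have {}dP := dP n x x xa xb; have {}d'P := d'P n x x xa xb.
set S := \sum_(i < n) _ in dP d'P.
have -> : I - I' = (S - I') - (S - I) by rewrite opprB [RHS]addrC addrA subrK.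
apply: le_trans (ler_rnormD _ _) _; rewrite rnormN (splitr e) addrC lerD ?ltW//.
  apply: dP => i /xP[xi]; rewrite lt_min => /andP[h1 h2].
  by rewrite lexx xi.
apply: d'P => i /xP[xi]; rewrite lt_min => /andP[h1 h2].
by rewrite lexx xi.
Qed.

Lemma is_riemann_integralD g h a b I I' :
  is_riemann_integral g a b I -> is_riemann_integral h a b I' ->
  is_riemann_integral (fun t => g t + h t) a b (I + I').
Proof.
move=> gI hI e e0; have e20 : 0 < e / 2 by rewrite divr_gt0.
have [d d0 dP] := gI _ e20; have [d' d'0 d'P] := hI _ e20.
exists (Num.min d d'); first by rewrite lt_min d0.
move=> n x xi xa xb xP.
have {}dP := dP n x xi xa xb; have {}d'P := d'P n x xi xa xb.
have -> : \sum_(i < n) of_real (x i.+1 - x i) *: (g (xi i) + h (xi i)) - (I + I') =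
  (\sum_(i < n) of_real (x i.+1 - x i) *: g (xi i) - I) +
  (\sum_(i < n) of_real (x i.+1 - x i) *: h (xi i) - I').
  rewrite addrACA -opprD -big_split/=; congr (_ - _).
  by apply: eq_bigr => i _; rewrite scalerDr.
apply: le_lt_trans (ler_rnormD _ _) _; rewrite (splitr e) ltrD//.
  by apply: dP => i /xP[xii]; rewrite lt_min => /andP[h1 h2].
by apply: d'P => i /xP[xii]; rewrite lt_min => /andP[h1 h2].
Qed.

Lemma is_riemann_integral_comp (Y : normedModType (scalars R s))
    (A : {linear X -> Y}) g a b I :
  (forall u, rnorm (A u) <= rnorm u) ->
  is_riemann_integral g a b I -> is_riemann_integral (A \o g) a b (A I).
Proof.
move=> A1 gI e e0; have [d d0 dP] := gI e e0; exists d => // n x xi xa xb xP.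
have -> : \sum_(i < n) of_real (x i.+1 - x i) *: (A \o g) (xi i) - A I =
    A (\sum_(i < n) of_real (x i.+1 - x i) *: g (xi i) - I).
  by rewrite linearB linear_sum/=; under [in RHS]eq_bigr do rewrite linearZ.
exact: le_lt_trans (A1 _) (dP _ _ _ xa xb xP).
Qed.

Lemma is_riemann_integralZ (q : R -> R) (v : X) a b (I : R) :
  @is_riemann_integral R RealScalars R^o q a b I ->
  is_riemann_integral (fun t => of_real (q t) *: v) a b (of_real I *: v).
Proof.
move=> qI e e0; have v0 : 0 < rnorm v + 1 by rewrite ltr_wpDl ?rnorm_ge0.
have [d d0 dP] := qI _ (divr_gt0 e0 v0); exists d => // n x xi xa xb xP.
have -> : \sum_(i < n) of_real (x i.+1 - x i) *: (of_real (q (xi i)) *: v) -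
    of_real I *: v = of_real (\sum_(i < n) (x i.+1 - x i) * q (xi i) - I) *: v.
  rewrite of_realD of_realN scalerBl; congr (_ - _).
  rewrite (big_morph _ (@of_realD R s) (@of_real0 R s)) scaler_suml.
  by apply: eq_bigr => i _; rewrite of_realM scalerA.
rewrite rnormZ_of_real; have := dP _ _ _ xa xb xP.
rewrite ltr_pdivlMr//; apply: le_lt_trans; rewrite ler_wpM2l// lerDl//.
Qed.

Lemma is_riemann_integral_sum (m : nat) (g : 'I_m -> R -> X) a b (I : 'I_m -> X) :
  (forall i, is_riemann_integral (g i) a b (I i)) ->
  is_riemann_integral (fun t => \sum_(i < m) g i t) a b (\sum_(i < m) I i).
Proof.
elim: m g I => [|m IH] g I gI.
  move=> e e0; exists 1 => // n x xi _ _ _.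
  rewrite !big_ord0 subr0 big1 ?rnorm0// => i _.
  by rewrite big_ord0 scaler0.
rewrite big_ord_recr/=.
have -> : (fun t => \sum_(i < m.+1) g i t) =
    (fun t => \sum_(i < m) g (widen_ord (leqnSn m) i) t + g ord_max t).
  by apply/funext => t; rewrite big_ord_recr.
apply: is_riemann_integralD; last exact: gI.
by apply: (IH (fun i => g (widen_ord (leqnSn m) i))) => i; exact: gI.
Qed.

End riemann_integral.

Section real_riemann_integral.
Context {R : realType}.
Local Notation is_rint := (@is_riemann_integral R RealScalars R^o).
Implicit Types (g G : R -> R) (a b L : R).

(** On each cell the mean value theorem expresses the increment of [G] through [g] at some point of
    the cell. Moving from that point to the tag costs at most [L] times the mesh, and the increments
    telescope. *)
Lemma is_rint_lipschitz g G a b L : a <= b -> 0 <= L ->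
  (forall x, a <= x <= b -> is_derive x 1 G (g x)) ->
  (forall x y, `|g x - g y| <= L * `|x - y|) ->
  is_rint g a b (G b - G a).
Proof.
move=> ab L0 dG gL e e0.
have q0 : 0 < L * (b - a) + 1 by rewrite ltr_wpDl// mulr_ge0// subr_ge0.
(* The total error is at most [L * d * (b - a)]; the added 1 keeps the denominator positive and the
   final inequality strict. *)
exists (e / (L * (b - a) + 1)); first exact: divr_gt0.
move=> n x xi xa xb xP; set d := e / _ in xP.
have d0 : 0 < d by exact: divr_gt0.
have GE : G b - G a = \sum_(i < n) (G (x i.+1) - G (x i)).
  by rewrite -xb -xa -(big_mkord predT (fun i => G (x i.+1) - G (x i))) telescope_sumr.
rewrite GE -sumrB.
apply: (@le_lt_trans _ _ (\sum_(i < n) L * d * (x i.+1 - x i))).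
  rewrite rnorm_scalar; apply: le_trans (ler_norm_sum _ _ _) _; apply: ler_sum => i _.
  have [/andP[h1 h2] h3] := xP i (ltn_ord i).
  have /andP[m1 _] : a <= x i <= b.
    rewrite -xa -xb; apply: (@partition_mem _ n x x d) => // j jlt.
    by have [/andP[k1 k2] k3] := xP j jlt; rewrite lexx (le_trans k1 k2).
  have /andP[_ m2] : a <= x i.+1 <= b.
    rewrite -xa -xb; apply: (@partition_mem _ n x (fun i => x i.+1) d _ i) => // j jlt.
    by have [/andP[k1 k2] k3] := xP j jlt; rewrite lexx (le_trans k1 k2).
  have [c /andP[c1 c2] ->] := mean_value dG m1 (le_trans h1 h2) m2.
  rewrite -[X in X - _]/((x i.+1 - x i) * g (xi i)) [X in X - _]mulrC -mulrBl.
  have x0 : 0 <= x i.+1 - x i by rewrite subr_ge0 (le_trans h1 h2).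
  rewrite normrM (ger0_norm x0) ler_wpM2r//.
  apply: le_trans (gL _ _) _; rewrite ler_wpM2l//.
  by rewrite ler_norml; apply/andP; split; lra.
rewrite -mulr_sumr -(big_mkord predT (fun i => x i.+1 - x i)) telescope_sumr// xa xb.
rewrite /d mulrAC mulrCA -[X in _ < X]mulr1 ltr_pM2l// ltr_pdivrMr// mul1r.
by rewrite ltrDl.
Qed.

(* The mean value theorem provides tags for which the Riemann sum telescopes. *)
Lemma is_rint_antiderivative g G a b I : a <= b ->
  (forall x, a <= x <= b -> is_derive x 1 G (g x)) ->
  is_rint g a b I -> I = G b - G a.
Proof.
move=> ab dG gI; apply/eqP; rewrite -subr_eq0 -normr_le0.
apply/ler_addgt0Pr => e e0; rewrite add0r.
have [d d0 dP] := gI e e0.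
have [n [x [xa xb xP]]] := exists_partition ab d0.
have /choice[xi xiP] : forall i, exists c : R, (i < n)%N ->
    x i <= c <= x i.+1 /\ G (x i.+1) - G (x i) = g c * (x i.+1 - x i).
  move=> i; have [ilt|] := ltnP i n; last by exists 0.
  have m1 : a <= x i <= b.
    rewrite -xa -xb; apply: (@partition_mem _ n x x d) => // j jlt.
    by have [k1 k2] := xP j jlt; rewrite lexx k1.
  have m2 : a <= x i.+1 <= b.
    rewrite -xa -xb; apply: (@partition_mem _ n x (fun i => x i.+1) d _ i) => // j jlt.
    by have [k1 k2] := xP j jlt; rewrite lexx k1.
  have [c cP cE] := mean_value dG (andP m1).1 (xP _ ilt).1 (andP m2).2.
  by exists c.
have := dP n x xi xa xb _; rewrite rnorm_scalar.
rewrite (_ : \sum_(i < n) _ = G b - G a); last first.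
  rewrite -xb -xa -(telescope_sumr (fun i => G (x i)) (leq0n n)) big_mkord.
  by apply: eq_bigr => i _; rewrite (xiP i (ltn_ord i)).2 mulrC.
by rewrite distrC => h; apply/ltW/h => i ilt; rewrite (xiP i ilt).1 (xP i ilt).2.
Qed.

End real_riemann_integral.

(** * Means over the windows of either time line *)

Section means_theory.
Context {R : realType}.

(** Means are averages over [[window_left J T, T]]. With this left end both time lines are handled
    together, and the weight in [is_mean] is the inverse of the window length. *)
Definition window_left (J : timeline) (T : R) : R :=
  match J with HalfLine => 0 | WholeLine => - T end.

Lemma window_weight J (T : R) :
  match J with HalfLine => T^-1 | WholeLine => (2 * T)^-1 end =
  (T - window_left J T)^-1.
Proof. by case: J => /=; rewrite ?subr0// opprK mulr2n mulrDl mul1r. Qed.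

Lemma window_length J (T : R) : 0 < T -> T <= T - window_left J T.
Proof. by case: J => /= T0; lra. Qed.

Lemma window_left_ge J (T : R) : 0 < T -> - T <= window_left J T <= 0.
Proof. by case: J => /= T0; apply/andP; split; lra. Qed.

Lemma window_left_mem (J : timeline) (T t : R) : window_left J T <= t -> tset J t.
Proof. by case: J => //=; rewrite in_itv/= andbT. Qed.

Lemma valL_tproj (s : scalar_kind) (J : timeline) (X : normedModType (scalars R s))
    (g : time R J -> X) (T t : R) : window_left J T <= t ->
  'valL_0 g t = g (tproj t).
Proof.
move=> /window_left_mem tJ; rewrite -{1}(set_val_tproj tJ).
exact: (congr1 (fun h => h (tproj t)) (valLK 0 g)).
Qed.

Context {s : scalar_kind} {J : timeline} {X : normedModType (scalars R s)}.

Lemma is_mean_unique (g : time R J -> X) m m' : is_mean g m -> is_mean g m' -> m = m'.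
Proof.
move=> [I gI Im] [I' gI' Im'].
have II' T : 0 < T -> I T = I' T.
  move=> T0; apply: is_riemann_integral_unique (gI T T0) (gI' T T0).
  by case: (J); lra.
apply: (@cvg_unique _ (@norm_hausdorff _ X) _ _ _ _ Im).
apply: cvg_trans Im'; apply: near_eq_cvg; near=> T; rewrite II'//.
Unshelve. all: by end_near. Qed.

Lemma is_meanD (g h : time R J -> X) m m' : is_mean g m -> is_mean h m' ->
  is_mean (fun t => g t + h t) (m + m').
Proof.
move=> [I gI Im] [I' hI Im']; exists (fun T => I T + I' T) => [T T0|].
  have := is_riemann_integralD (gI T T0) (hI T T0).
  apply: is_riemann_integral_ext => t /andP[ta _].
  by rewrite !(valL_tproj _ ta).
under eq_fun do rewrite scalerDr.
exact: cvgD.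
Qed.

Lemma is_mean_comp (Y : normedModType (scalars R s)) (A : {linear X -> Y})
    (g : time R J -> X) : (forall u, rnorm (A u) <= rnorm u) ->
  is_mean g 0 -> is_mean (A \o g) 0.
Proof.
move=> A1 [I gI Im]; exists (A \o I) => [T T0|].
  have := is_riemann_integral_comp A1 (gI T T0).
  apply: is_riemann_integral_ext => t /andP[ta _].
  by rewrite (valL_tproj _ ta) -[LHS]/(A ('valL_0 g t)) (valL_tproj _ ta).
apply/rnorm_cvgP => e e0; move/rnorm_cvgP : Im => /(_ e e0).
apply: filterS => T; rewrite !sub0r !rnormN -linearZ; exact: le_trans.
Qed.

End means_theory.

Section scalar_means.
Context {R : realType} {J : timeline}.

(** The primitive stays within [B] of a line of slope [m], so an average differs from [m] by at most
    [2 * B] divided by the window length. *)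
Lemma is_mean_antiderivative (q P : R -> R) (L B m : R) (g : time R J -> R^o) :
  0 <= L -> (forall x y, `|q x - q y| <= L * `|x - y|) ->
  (forall x : R, is_derive x 1 P (q x)) -> (forall x, `|P x - m * x| <= B) ->
  (forall t, g t = q (set_val t)) -> @is_mean R RealScalars R^o J g m.
Proof.
move=> L0 qL dP PB gq; exists (fun T => P T - P (window_left J T)) => [T T0|].
  have aT : window_left J T <= T by have := window_left_ge J T0; lra.
  have := is_rint_lipschitz aT L0 (fun x _ => dP x) qL.
  apply: is_riemann_integral_ext => t /andP[ta _].
  by rewrite (valL_tproj _ ta) gq set_val_tproj//; exact: window_left_mem ta.
apply/(@rnorm_cvgP R RealScalars R^o) => e e0; near=> T.
have T0 : 0 < T by [].
have wl := window_length J T0.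
have w0 : 0 < T - window_left J T by lra.
rewrite window_weight rnorm_scalar.
set a := window_left J T in wl w0 *.
rewrite -[X in m - X]/((T - a)^-1 * (P T - P a)).
have -> : m - (T - a)^-1 * (P T - P a) =
    (P a - m * a - (P T - m * T)) / (T - a) by field; lra.
rewrite normrM normfV (gtr0_norm w0) ler_pdivrMr//.
apply: le_trans (ler_normB _ _) _; have := PB a; have := PB T => h1 h2.
apply: (@le_trans _ _ (2 * B)); first by lra.
apply: (@le_trans _ _ (e * T)); last by rewrite ler_pM2l.
by rewrite -ler_pdivrMl// mulrC; near: T; exact: nbhs_pinfty_ge.
Unshelve. all: by end_near. Qed.

End scalar_means.

(** * Functions moving through an orthonormal family *)

Section spread.
Context {R : realType} {s : scalar_kind} {X : normedModType (scalars R s)}.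

Definition spread (e : int -> X) (q : R -> R) (t : R) : X :=
  of_real (q t) *: e (Num.floor t).

(** Between points of different unit cells there is an integer, where [q] vanishes, so the jump of
    direction costs nothing. *)
Lemma spread_lipschitz (e : int -> X) (q : R -> R) (L : R) :
  0 <= L -> (forall n, rnorm (e n) <= 1) ->
  (forall x y, `|q x - q y| <= L * `|x - y|) ->
  (forall n : int, q n%:~R = 0) ->
  forall x y, rnorm (spread e q x - spread e q y) <= L * `|x - y|.
Proof.
move=> L0 e1 qL q0.
have eb (c : R) n : rnorm (of_real c *: e n) <= `|c|.
  by rewrite rnormZ_of_real ler_piMr.
suff xyP x y : x <= y -> rnorm (spread e q x - spread e q y) <= L * `|x - y|.
  move=> x y; have [|/ltW] := leP x y; first exact: xyP.
  by rewrite rnorm_distC distrC; exact: xyP.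
move=> xy; rewrite /spread; have [->|nxy] := eqVneq (Num.floor x) (Num.floor y).
  by rewrite -scalerBl -of_realN -of_realD; exact: le_trans (eb _ _) (qL _ _).
(* Since [x < k <= y], |q x| + |q y| is at most L (k - x) + L (y - k) = L (y - x). *)
set k := Num.floor y.
have xk : x < k%:~R.
  by rewrite -floor_lt_int lt_neqAle nxy le_floor.
have ky : k%:~R <= y by exact: floor_le.
have qx : `|q x| <= L * (k%:~R - x).
  have := qL x k%:~R; rewrite q0 subr0 => /le_trans; apply.
  by rewrite distrC ger0_norm// subr_ge0 ltW.
have qy : `|q y| <= L * (y - k%:~R).
  have := qL y k%:~R; rewrite q0 subr0 => /le_trans; apply.
  by rewrite ger0_norm// subr_ge0.
apply: le_trans (ler_rnormD _ _) _; rewrite rnormN.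
apply: le_trans (lerD (eb _ _) (eb _ _)) _.
apply: le_trans (lerD qx qy) _; rewrite distrC ger0_norm ?subr_ge0// -mulrDr.
by rewrite (_ : k%:~R - x + (y - k%:~R) = y - x)//; ring.
Qed.

End spread.

Section cell_integral.
Context {R : realType}.
Implicit Types (q G : R -> R) (n : int).

(** The part of [q] on the cell from [n] to [n + 1]. Written as a scalar [spread] along the
    indicator of [n], it inherits its Lipschitz bound from [spread_lipschitz]. *)
Definition cell q n : R -> R :=
  @spread R RealScalars R^o (fun m => (m == n)%:R) q.

Lemma cellE q n t : cell q n t = q t * (Num.floor t == n)%:R.
Proof. by []. Qed.

Lemma cell_eq0 q n t : (forall m : int, q m%:~R = 0) ->
  (t <= n%:~R) || ((n + 1)%:~R <= t) -> cell q n t = 0.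
Proof.
move=> q0; rewrite cellE floor_eq => /orP[tn|nt].
  have [->|tn'] := eqVneq t n%:~R; first by rewrite q0 mul0r.
  by rewrite [n%:~R <= t]leNgt lt_neqAle tn' tn mulr0.
by rewrite [t < _]ltNge nt andbF mulr0.
Qed.

Lemma ler_norm_cell q n t (M : R) : (forall t, `|q t| <= M) -> `|cell q n t| <= M.
Proof.
move=> qM; rewrite cellE; case: (_ == _); rewrite ?mulr1// mulr0 normr0.
exact: le_trans (normr_ge0 _) (qM 0).
Qed.

Lemma cell_lipschitz q n (L : R) : 0 <= L ->
  (forall x y, `|q x - q y| <= L * `|x - y|) ->
  (forall m : int, q m%:~R = 0) ->
  forall x y, `|cell q n x - cell q n y| <= L * `|x - y|.
Proof.
move=> L0 qL q0 x y.
apply: (@spread_lipschitz R RealScalars R^o) => // m.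
by rewrite rnorm_scalar; case: (m == n); rewrite ?normr1 ?normr0.
Qed.

(** [G] is constant on either side of the unit cell, so both end points can be clamped to the cell,
    where an increment is at most [M] times the length 1. *)
Lemma cell_integral_bound q n G (a b x y M : R) :
  (forall m : int, q m%:~R = 0) -> (forall t, `|q t| <= M) ->
  (forall t, a <= t <= b -> is_derive t 1 G (cell q n t)) ->
  a <= n%:~R -> (n + 1)%:~R <= b -> a <= x -> x <= y -> y <= b ->
  `|G y - G x| <= M.
Proof.
move=> q0 qM dG an nb ax xy yb.
have M0 : 0 <= M by exact: le_trans (normr_ge0 _) (qM 0).
pose c t : R := Num.min (Num.max t n%:~R) (n + 1)%:~R.
have nn1 : n%:~R <= (n + 1)%:~R :> R by rewrite ler_int lerDl.
have cn t : n%:~R <= c t <= (n + 1)%:~R.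
  by rewrite /c le_min le_max lexx orbT nn1 ge_min lexx orbT.
have Gc t : a <= t -> t <= b -> G t = G (c t).
  move=> at_ tb; rewrite /c; have [tn|nt] := leP t n%:~R.
    rewrite min_l//; have [u /andP[_ un] GE] := mean_value dG at_ tn (le_trans nn1 nb).
    apply/eqP; rewrite eq_sym -subr_eq0 GE (@cell_eq0 _ _ u)// ?un// mul0r//.
  have [//|n1t] := leP t (n + 1)%:~R.
  have [u /andP[un _] GE] := mean_value dG (le_trans an nn1) (ltW n1t) tb.
  by apply/eqP; rewrite -subr_eq0 GE (@cell_eq0 _ _ u)// ?un ?orbT// mul0r.
have cxy : c x <= c y by rewrite /c le_min !ge_min ge_max !le_max xy !lexx !orbT.
rewrite (Gc x)// ?(le_trans xy yb)// (Gc y)// ?(le_trans ax xy)//.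
have [/andP[cx1 cx2] /andP[cy1 cy2]] := (cn x, cn y).
have [u _ ->] := mean_value dG (le_trans an cx1) cxy (le_trans cy2 nb).
rewrite normrM -[M]mulr1 ler_pM//; first exact: ler_norm_cell.
rewrite ger0_norm ?subr_ge0//.
by move: cy2 cx1; rewrite intrD => ? ?; lra.
Qed.

End cell_integral.

Section spread_mean.
Context {R : realType} {s : scalar_kind} {H : completeNormedModType (scalars R s)}.
Variables (ip : {dot H for @conj_scalar R s}) (e : int -> H).
Hypothesis ipE : forall x : H, `|x| ^+ 2 = ip x x.
Hypothesis e_orthonormal : forall m n, ip (e m) (e n) = (m == n)%:R.

Lemma rnorm_orthonormal n : rnorm (e n) = 1.
Proof.
have /eqP := @rnorm_sqrE _ _ _ _ ipE (e n).
rewrite e_orthonormal eqxx -of_real1 (inj_eq (can_inj (@of_realK R s))).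
by rewrite sqrf_eq1 => /orP[/eqP//|/eqP h]; have := rnorm_ge0 (e n); rewrite h; lra.
Qed.

Lemma rnorm_spread (q : R -> R) t : rnorm (spread e q t) = `|q t|.
Proof. by rewrite rnormZ_of_real rnorm_orthonormal mulr1. Qed.

Lemma ip_spread (q : R -> R) t u :
  Num.floor t != Num.floor u -> ip (spread e q t) (spread e q u) = 0.
Proof.
by move=> /negbTE tu; rewrite ipZl ipZr e_orthonormal tu !mulr0.
Qed.

(** Splitting into unit cells writes the integral as a sum of [N.*2] orthogonal vectors of norm at
    most [M], so its norm grows like the square root of the window length. *)
Lemma spread_integral (q : R -> R) (L M T a b : R) :
  0 <= L -> (forall x y, `|q x - q y| <= L * `|x - y|) ->
  (forall n : int, q n%:~R = 0) -> (forall t, `|q t| <= M) ->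
  0 < T -> - T <= a -> a <= b -> b <= T ->
  exists2 I, is_riemann_integral (spread e q) a b I &
    rnorm I ^+ 2 <= 2 * (T + 1) * M ^+ 2.
Proof.
move=> L0 qL q0 qM T0 Ta ab bT.
(* [N] exceeds [T] strictly, so the integer parts of points of the window are at least [- N] and
   less than [N]; the cells are numbered from 0 by [nn i = i - N]. *)
pose N := (Num.truncn T).+1.
have TN : T < N%:R by exact: truncnS_gt.
have NT : N%:R <= T + 1 by rewrite /N -natr1 lerD2r truncn_le ltW.
pose nn (i : nat) : int := i%:Z - N%:Z.
have nnR i : (nn i)%:~R = i%:R - N%:R :> R by rewrite /nn intrB.
have qnL n := cell_lipschitz n L0 qL q0.
have cqn n : continuous (cell q n).
  exact: (@rnorm_lipschitz_continuous R RealScalars R^o _ L (qnL n)).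
have /choice[G dG] : forall i : nat, exists G : R -> R, forall t : R, - N%:R <= t <= N%:R ->
    is_derive t 1 G (cell q (nn i) t).
  by move=> i; exact: exists_antiderivative.
exists (\sum_(i < N.*2) of_real (G i b - G i a) *: e (nn i)).
  have gI (i : 'I_N.*2) : is_riemann_integral
      (fun t => of_real (cell q (nn i) t) *: e (nn i)) a b
      (of_real (G i b - G i a) *: e (nn i)).
    apply: is_riemann_integralZ; apply: is_rint_lipschitz ab L0 _ (qnL _) => t tab.
    by apply: dG; lra.
  have := is_riemann_integral_sum gI; apply: is_riemann_integral_ext => t tab.
  have f1 : - N%:Z <= Num.floor t.
    by rewrite floor_ge_int rmorphN/=; lra.
  have f2 : Num.floor t < N%:Z by rewrite floor_lt_int; lra.
  (* Only cell number [k] contains [t]; the other terms of the sum vanish. *)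
  have [k kE] : exists k : nat, Num.floor t + N%:Z = k%:Z.
    by exists (absz (Num.floor t + N%:Z)); rewrite gez0_abs// -lerBlDr sub0r.
  have kN : (k < N.*2)%N by rewrite -ltz_nat -addnn PoszD -kE ltrD2r.
  rewrite (bigD1 (Ordinal kN))//= big1 ?addr0 => [|i ik].
    have <- : Num.floor t = nn k by rewrite /nn -kE addrK.
    by rewrite cellE eqxx mulr1.
  rewrite cellE; have -> : (Num.floor t == nn i) = false.
    apply/negbTE; apply: contra_neq ik => fi.
    by apply: val_inj => /=; apply/eqP; rewrite -eqz_nat -kE fi /nn subrK.
  by rewrite mulr0 of_real0 scale0r.
rewrite (pythagoras (n := N.*2) ipE (v := fun i => of_real (G i b - G i a) *: e (nn i))); last first.
  move=> i j _ _ ij; rewrite ipZl ipZr e_orthonormal.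
  have -> : (nn i == nn j) = false; last by rewrite !mulr0.
  by apply/negbTE; apply: contra_neq ij => /addIr[].
apply: (@le_trans _ _ (\sum_(i < N.*2) M ^+ 2)).
  apply: ler_sum => i _; rewrite rnormZ_of_real rnorm_orthonormal mulr1.
  rewrite lerXn2r ?nnegrE//; first exact: le_trans (normr_ge0 _) (qM 0).
  have i2 : i.+1%:R <= N%:R + N%:R :> R.
    by rewrite -natrD ler_nat addnn.
  apply: (@cell_integral_bound _ q (nn i) (G i) (- N%:R) N%:R) => //.
  - by rewrite nnR lerBrDr addNr.
  - by rewrite intrD nnR; move: i2; rewrite -natr1 => i2; lra.
  - by lra.
  - by lra.
rewrite sumr_const card_ord -[X in X <= _]mulr_natl ler_wpM2r ?sqr_ge0//.
by rewrite -muln2 natrM; lra.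
Qed.

(** By [spread_integral] the integral is of order sqrt T, while the weight is at most 1/T. *)
Lemma is_mean_spread (J : timeline) (q : R -> R) (L M : R) :
  0 <= L -> (forall x y, `|q x - q y| <= L * `|x - y|) ->
  (forall n : int, q n%:~R = 0) -> (forall t, `|q t| <= M) ->
  is_mean (fun t : time R J => spread e q (set_val t)) 0.
Proof.
move=> L0 qL q0 qM.
have /choice[I IP] : forall T : R, exists I : H, 0 < T ->
    is_riemann_integral (spread e q) (window_left J T) T I /\
    rnorm I ^+ 2 <= 2 * (T + 1) * M ^+ 2.
  move=> T; have [T0|T0] := ltP 0 T; last by exists 0.
  have /andP[l1 l2] := window_left_ge J T0.
  have [I I1 I2] := spread_integral L0 qL q0 qM T0 l1 (le_trans l2 (ltW T0)) (lexx T).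
  by exists I.
exists I => [T T0|].
  have [+ _] := IP T T0; apply: is_riemann_integral_ext => t /andP[ta _].
  by rewrite (valL_tproj _ ta) set_val_tproj//; exact: window_left_mem ta.
apply/rnorm_cvgP => r r0; near=> T.
have T0 : 0 < T by [].
have T1 : 1 <= T by near: T; exact: nbhs_pinfty_ge.
have [_ IT] := IP T T0.
have wl := window_length J T0.
have w0 : 0 < T - window_left J T by lra.
rewrite sub0r rnormN rnormZ_of_real window_weight normfV gtr0_norm//.
rewrite mulrC ler_pdivrMr//; apply: (@le_trans _ _ (r * T)); last by rewrite ler_pM2l.
rewrite -ler_sqr ?nnegrE ?rnorm_ge0//; last by rewrite mulr_ge0// ltW.
(* From [T >= 1] follows [T + 1 <= 2 * T]; what then remains is that [T] is at least 4 M^2 / r^2. *)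
apply: le_trans IT _; apply: (@le_trans _ _ (T * (4 * M ^+ 2))).
  have : 0 <= (T - 1) * M ^+ 2 by rewrite mulr_ge0 ?sqr_ge0 ?subr_ge0.
  by rewrite !mulrDl !mulrDr; lra.
rewrite exprMn [T ^+ 2]expr2 [r ^+ 2 * _]mulrA [X in X <= _]mulrC ler_pM2r// -ler_pdivrMl ?exprn_gt0//.
Unshelve. all: by end_near. Qed.

End spread_mean.

(** * The periodic profile *)

Section hump.
Context {R : realType}.
Implicit Types (t x y c : R).

Lemma derive_lipschitz (g dg : R -> R) (k : R) :
  (forall x, is_derive x 1 g (dg x)) -> (forall x, `|dg x| <= k) ->
  forall x y, `|g x - g y| <= k * `|x - y|.
Proof.
move=> dgP dgk.
suff xyP x y : x <= y -> `|g x - g y| <= k * `|x - y|.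
  move=> x y; have [|/ltW] := leP x y; first exact: xyP.
  by rewrite distrC [`|x - y|]distrC; exact: xyP.
move=> xy; have [c _ gE] := @mean_value R dg g x y (fun t _ => dgP t) x y (lexx x) xy (lexx y).
by rewrite distrC gE [`|x - y|]distrC normrM ler_wpM2r.
Qed.

Lemma is_derive_sinM c x : is_derive x 1 (fun t => sin (c * t)) (c * cos (c * x)).
Proof.
have dl : is_derive x 1 (c \*: @id R) (c *: 1) by exact: is_deriveZ.
have := @is_derive1_comp R sin (c \*: @id R) x _ _ (is_derive_sin _) dl.
by rewrite [_ *: 1]mulr1 mulrC.
Qed.

Lemma is_derive_cosM c x : is_derive x 1 (fun t => cos (c * t)) (- c * sin (c * x)).
Proof.
have dl : is_derive x 1 (c \*: @id R) (c *: 1) by exact: is_deriveZ.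
have := @is_derive1_comp R cos (c \*: @id R) x _ _ (is_derive_cos _) dl.
by rewrite [_ *: 1]mulr1 mulrC mulrN -mulNr.
Qed.

Lemma cosM_lipschitz c x y : `|cos (c * x) - cos (c * y)| <= `|c| * `|x - y|.
Proof.
apply: (derive_lipschitz (is_derive_cosM c)) => {}x.
by rewrite normrM normrN ler_piMr// sin_max.
Qed.

Lemma sinM_lipschitz c x y : `|sin (c * x) - sin (c * y)| <= `|c| * `|x - y|.
Proof.
apply: (derive_lipschitz (is_derive_sinM c)) => {}x.
by rewrite normrM ler_piMr// cos_max.
Qed.

Lemma lipschitzM (g h : R -> R) (A B L M : R) :
  (forall x, `|g x| <= A) -> (forall x, `|h x| <= B) ->
  (forall x y, `|g x - g y| <= L * `|x - y|) ->
  (forall x y, `|h x - h y| <= M * `|x - y|) ->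
  forall x y, `|g x * h x - g y * h y| <= (A * M + B * L) * `|x - y|.
Proof.
move=> gA hB gL hM x y.
have -> : g x * h x - g y * h y = g x * (h x - h y) + h y * (g x - g y) by ring.
apply: le_trans (ler_normD _ _) _; rewrite !normrM mulrDl -!mulrA lerD//.
  exact: ler_pM.
exact: ler_pM.
Qed.

Definition freq : R := pi *+ 2.

Lemma freq_gt0 : 0 < freq.
Proof. by rewrite /freq mulrn_wgt0// pi_gt0. Qed.

Definition hump t : R := 1 - cos (freq * t).

Lemma hump_ge0 t : 0 <= hump t.
Proof. by rewrite subr_ge0 cos_le1. Qed.

Lemma hump_le2 t : hump t <= 2.
Proof. by rewrite /hump; have := cos_geN1 (freq * t); lra. Qed.

Lemma ler_norm_hump t : `|hump t| <= 2.
Proof. by rewrite ger0_norm ?hump_ge0// hump_le2. Qed.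

Lemma humpDint t (n : int) : hump (t + n%:~R) = hump t.
Proof.
have P (m : nat) u : cos (u + freq * m%:R) = cos u.
  elim: m u => [|m IH] u; first by rewrite mulr0 addr0.
  by rewrite -natr1 mulrDr mulr1 addrA cosD2pi.
rewrite /hump mulrDr; congr (1 - _); case: n => m; first exact: P.
by rewrite NegzE mulrNz mulrN -[LHS](P m.+1) subrK.
Qed.

Lemma hump_int (n : int) : hump n%:~R = 0.
Proof. by rewrite -[n%:~R]add0r humpDint /hump mulr0 cos0 subrr. Qed.

Lemma hump_half (n : int) : hump (n%:~R + 2^-1) = 2.
Proof.
rewrite addrC humpDint /hump; have -> : freq / 2 = pi by rewrite /freq; lra.
by rewrite cospi; lra.
Qed.

Lemma hump_lipschitz x y : `|hump x - hump y| <= freq * `|x - y|.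
Proof.
have -> : hump x - hump y = cos (freq * y) - cos (freq * x) by rewrite /hump; ring.
by apply: le_trans (cosM_lipschitz _ _ _) _; rewrite gtr0_norm ?freq_gt0// distrC.
Qed.

Lemma hump_sqr_lipschitz x y :
  `|hump x ^+ 2 - hump y ^+ 2| <= (2 * freq + 2 * freq) * `|x - y|.
Proof.
rewrite !expr2.
exact: (lipschitzM ler_norm_hump ler_norm_hump hump_lipschitz hump_lipschitz).
Qed.

Definition hump_prim t : R := t - freq^-1 * sin (freq * t).

Lemma is_derive_hump_prim x : is_derive x 1 hump_prim (hump x).
Proof.
have d1 : is_derive x 1 (freq^-1 \*: (fun t => sin (freq * t)))
    (freq^-1 *: (freq * cos (freq * x))).
  by apply: is_deriveZ; exact: is_derive_sinM.
have := @is_deriveB _ _ _ (@id R) _ x 1 1 _ (is_derive_id x 1) d1.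
by rewrite [_ *: _]mulrA mulVf ?mul1r// gt_eqF// freq_gt0.
Qed.

Lemma hump_prim_bound x : `|hump_prim x - 1 * x| <= freq^-1.
Proof.
rewrite /hump_prim mul1r addrAC subrr add0r normrN normrM normfV (gtr0_norm freq_gt0).
by rewrite ler_piMr// ?sin_max// invr_ge0 (ltW freq_gt0).
Qed.

(** Integrates (1 - cos u)^2 = 3/2 - 2 cos u + cos(2u)/2 with u = freq t; the slope of the linear
    term is the mean. *)
Definition hump_sqr_prim t : R :=
  3 / 2 * t + (- 2 / freq * sin (freq * t) + (4 * freq)^-1 * sin ((2 * freq) * t)).

Lemma is_derive_hump_sqr_prim x : is_derive x 1 hump_sqr_prim (hump x ^+ 2).
Proof.
have f0 := freq_gt0.
have d0 : is_derive x 1 ((3 / 2) \*: @id R) ((3 / 2 : R) *: 1) by exact: is_deriveZ.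
have d1 : is_derive x 1 ((- 2 / freq) \*: (fun t => sin (freq * t)))
    ((- 2 / freq) *: (freq * cos (freq * x))).
  by apply: is_deriveZ; exact: is_derive_sinM.
have d2 : is_derive x 1 ((4 * freq)^-1 \*: (fun t => sin ((2 * freq) * t)))
    ((4 * freq)^-1 *: (2 * freq * cos ((2 * freq) * x))).
  by apply: is_deriveZ; exact: is_derive_sinM.
apply: is_derive_eq (is_deriveD d0 (is_deriveD d1 d2)) _.
rewrite -![_ *: _]/(_ * _) /hump.
have -> : cos (2 * freq * x) = 2 * cos (freq * x) ^+ 2 - 1.
  rewrite -mulrA mulr_natl cos_mulr2n -mulr_natl; ring.
by move: f0 (cos _) => /lt0r_neq0; move: freq => w w0 u; field.
Qed.

Lemma hump_sqr_prim_bound x :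
  `|hump_sqr_prim x - 3 / 2 * x| <= `|- 2 / freq| + `|(4 * freq)^-1|.
Proof.
rewrite /hump_sqr_prim addrAC subrr add0r.
apply: le_trans (ler_normD _ _) _; rewrite !normrM.
by rewrite lerD// ler_piMr ?mulr_ge0// sin_max.
Qed.

End hump.

(** * Periodic Lipschitz functions *)

Section periodic_functions.
Context {R : realType} {J : timeline}.
Variables (q : R -> R) (L : R) (f : @Cb R RealScalars J R^o).
Hypotheses (L0 : 0 <= L) (qL : forall x y, `|q x - q y| <= L * `|x - y|).
Hypothesis q_periodic : forall t (n : int), q (t + n%:~R) = q t.
Hypothesis fq : forall t, f t = q (set_val t).

Lemma periodic_AP : AP f.
Proof.
exists q; last by apply/funext => t; rewrite fq.
split; first exact: (@rnorm_lipschitz_continuous R RealScalars R^o _ L qL).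
(* Every interval of length 1 contains an integer, which is an exact period. *)
move=> e e0; exists 1 => // a; exists (Num.floor a + 1)%:~R.
  by have := floor_itv a; rewrite intrD => /andP[? ?]; apply/andP; split; lra.
by move=> t; rewrite q_periodic subrr rnorm0 ltW.
Qed.

(** Every translate equals the translate by the fractional part of its time, which is nonnegative
    and so lies in J. Hence the compact set of translates over the segment [0, 1] covers the
    orbit. *)
Lemma periodic_EAP : EAP f.
Proof.
have fL t u : rnorm (f t - f u) <= L * `|set_val t - set_val u|.
  by rewrite !fq; exact: qL.
apply: precompact_subset (compact_precompact weak_Cb_R_hausdorff
  (@compact_translates _ _ _ _ f L 0 1 L0 fL)).
move=> _ [a _ <-]; exists (set_val a - (Num.floor (set_val a))%:~R).
  have /andP[] := floor_itv (set_val a); rewrite intrD /= in_itv/= => ? ?.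
  by apply/andP; split; lra.
set r := _ - _; have r0 : tset J r.
  have := floor_le (set_val a); rewrite -subr_ge0 -/r; case: (J) => //= r0.
  by rewrite in_itv/= andbT.
apply/val_inj/funext => t.
rewrite -[LHS]/(f (tadd (tproj r) t)) -[RHS]/(f (tadd a t)) !fq !set_val_tadd.
rewrite set_val_tproj// -[RHS](q_periodic _ (- Num.floor (set_val a))) /r.
by rewrite rmorphN/= addrAC.
Qed.

End periodic_functions.

(** * The travelling hump *)

Section travelling_hump.
Context {R : realType} {s : scalar_kind} {J : timeline}.
Context {H : completeNormedModType (scalars R s)}.
Local Notation K := (scalars R s).
Variables (ip : {dot H for @conj_scalar R s}) (e : int -> H).
Hypothesis ipE : forall x : H, `|x| ^+ 2 = ip x x.
Hypothesis e_orthonormal : forall m n, ip (e m) (e n) = (m == n)%:R.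

Local Notation F := (spread e hump).

Let e1 n : rnorm (e n) <= 1.
Proof. by rewrite (rnorm_orthonormal ipE e_orthonormal). Qed.

Let freq0 : 0 <= freq :> R := ltW freq_gt0.

Lemma travelling_hump_lipschitz (x y : R) : rnorm (F x - F y) <= freq * `|x - y|.
Proof. exact: (spread_lipschitz freq0 e1 hump_lipschitz hump_int). Qed.

Lemma rnorm_travelling_hump t : rnorm (F t) = hump t.
Proof. by rewrite (rnorm_spread ipE e_orthonormal) ger0_norm ?hump_ge0. Qed.

Lemma travelling_hump_subproof :
  (fun t : time R J => F (set_val t)) \in bounded_continuous J H.
Proof.
apply/bounded_continuousP; split=> [t|].
  apply: (@continuous_comp _ _ _ set_val F); first exact: initial_continuous.
  exact: rnorm_lipschitz_continuous travelling_hump_lipschitz _.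
by exists 2 => t; rewrite rnorm_travelling_hump hump_le2.
Qed.

Definition travelling_hump : Cb J H := MkCb travelling_hump_subproof.
Local Notation f := travelling_hump.

Lemma floor_neq_far (x y : R) : 1 <= `|x - y| -> Num.floor x != Num.floor y.
Proof.
suff far (a b : R) : 1 <= a - b -> Num.floor a != Num.floor b.
  have [xy|xy] := leP 0 (x - y); first by rewrite ger0_norm//; exact: far.
  by rewrite ltr0_norm// opprB => /far; rewrite eq_sym.
move=> ab; apply/eqP => fab.
have /andP[_] := floor_itv a; have /andP[] := floor_itv b.
by rewrite fab intrD; lra.
Qed.

(* Translates at mutual distance at least 1 are pointwise orthogonal. *)
Lemma rnorm_sum_translates (n : nat) (a : nat -> time R J) (c : nat -> K) :
  (forall i j, i != j -> 1 <= `|set_val (a i) - set_val (a j)|) ->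
  (forall i, `|c i| = 1) ->
  rnorm (\sum_(i < n) c i *: translate (a i) f) ^+ 2 <= 4 * n%:R.
Proof.
move=> afar c1.
have sumE m t : (\sum_(i < m) c i *: translate (a i) f) t =
    \sum_(i < m) c i *: F (set_val (a i) + set_val t).
  elim: m => [|m IH]; first by rewrite !big_ord0.
  by rewrite !big_ord_recr/= -IH -set_val_tadd.
have bound : rnorm (\sum_(i < n) c i *: translate (a i) f) <= Num.sqrt (4 * n%:R).
  rewrite rnorm_CbE; apply: supnorm_le => t.
  rewrite -(@ger0_norm _ (rnorm _)) ?rnorm_ge0// -sqrtr_sqr ler_wsqrtr//.
  rewrite sumE (@pythagoras _ _ _ _ ipE n (fun i => c i *: F (set_val (a i) + set_val t))).
    apply: (@le_trans _ _ (\sum_(i < n) 4)).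
      apply: ler_sum => i _; rewrite rnormZ c1 rnorm_travelling_hump.
      rewrite -of_real1 of_realK mul1r.
      have := hump_ge0 (set_val (a i) + set_val t).
      have := hump_le2 (set_val (a i) + set_val t); move: (hump _) => h h2 h0.
      have : 0 <= (2 - h) * (2 + h) by rewrite mulr_ge0; lra.
      by rewrite expr2; lra.
    by rewrite sumr_const card_ord mulr_natr.
  move=> i j _ _ ij; rewrite ipZl ipZr (ip_spread e_orthonormal) ?mulr0//.
  by apply: floor_neq_far; rewrite opprD addrACA subrr addr0 afar.
rewrite -[leRHS]sqr_sqrtr ?mulr_ge0//.
by rewrite lerXn2r ?nnegrE ?rnorm_ge0 ?sqrtr_ge0.
Qed.

Lemma travelling_hump_weak_null (phi : dual (Cb J H)) (eps : R) : 0 < eps ->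
  exists M : R, forall a : time R J, M < `|set_val a| ->
    `|phi (translate a f)| <= of_real eps.
Proof.
move=> eps0; apply: contrapT => /forallNP noM.
have /choice[far farP] : forall M : R, exists a : time R J,
    M < `|set_val a| /\ of_real eps <= `|phi (translate a f)|.
  move=> M; have /existsNP[a /not_implyP[Ma aN]] := noM M; exists a; split => //.
  rewrite -of_real_norm in aN *; move/negP: aN.
  by rewrite !ler_of_real -ltNge => /ltW.
(* Each new time exceeds the previous one by more than 1 in absolute value, so any two of them are
   at distance at least 1. *)
pose a := fix a n := if n is m.+1 then far (`|set_val (a m)| + 1) else far 0.
have aS n : `|set_val (a n)| + 1 < `|set_val (a n.+1)| by exact: (farP _).1.
have a_eps n : of_real eps <= `|phi (translate (a n) f)|.
  by case: n => [|n]; exact: (farP _).2.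
have a_lt i k : `|set_val (a i)| + 1 <= `|set_val (a (i + k.+1)%N)|.
  elim: k => [|k IH]; first by rewrite addn1 ltW.
  rewrite addnS; apply: le_trans IH _; apply: ltW.
  by apply: le_lt_trans (aS (i + k.+1)%N); rewrite lerDl.
have a_far i j : i != j -> 1 <= `|set_val (a i) - set_val (a j)|.
  wlog ij : i j / (i < j)%N => [wl|_].
    rewrite neq_ltn => /orP[ij|ij]; first by rewrite wl// ltn_eqF.
    by rewrite distrC wl// ltn_eqF.
  have := a_lt i (j - i.+1)%N; rewrite -addSnnS subnKC// => aij.
  by rewrite distrC; apply: le_trans (lerB_dist _ _); rewrite lerBrDl.
have [C C0 phiC] := dual_bounded phi.
have [D CD] : exists D : R, C = of_real D.
  by exists (real_part C); rewrite of_real_ge0// ltW.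
have D0 : 0 < D by rewrite -(@ltr_of_real R s) -CD of_real0.
(* These unimodular factors turn each value of [phi] into its absolute value, so that nothing
   cancels in the sum. *)
pose c n : K := `|phi (translate (a n) f)| / phi (translate (a n) f).
have phi_neq0 n : phi (translate (a n) f) != 0.
  rewrite -normr_gt0; apply: lt_le_trans (a_eps n).
  by rewrite -of_real0 ltr_of_real.
have c1 n : `|c n| = 1.
  by rewrite normrM normr_id normfV divff// normr_eq0.
(* Squaring [n%:R * eps <= D * rnorm g], inserting the bound [4 * n%:R] on the squared norm of [g]
   and dividing by [n] leaves a bound on [n]. *)
have key n : n%:R * eps ^+ 2 <= 4 * D ^+ 2.
  have [->|n0] := eqVneq n 0%N; first by rewrite mul0r mulr_ge0 ?sqr_ge0.
  have := rnorm_sum_translates n a_far c1.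
  set g := \sum_(i < n) _ => g4.
  have phig : of_real (n%:R * eps) <= `|phi g|.
    have -> : phi g = \sum_(i < n) `|phi (translate (a i) f)|.
      by rewrite linear_sum; apply: eq_bigr => i _; rewrite linearZ/= [_ *: _]divfK.
    rewrite ger0_norm ?sumr_ge0//.
    apply: (@le_trans _ _ (\sum_(i < n) of_real eps)); last by apply: ler_sum.
    rewrite -(big_morph _ (@of_realD R s) (@of_real0 R s)) sumr_const card_ord.
    by rewrite mulr_natl.
  have : n%:R * eps <= D * rnorm g.
    by rewrite -(@ler_of_real R s) (of_realM D) of_real_rnorm -CD (le_trans phig).
  have ne0 : 0 <= n%:R * eps by rewrite mulr_ge0// ltW.
  move=> h; have := ler_pM ne0 ne0 h h => {}h.
  have n1 : 0 < n%:R :> R by rewrite ltr0n lt0n.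
  rewrite -(ler_pM2l n1); apply: le_trans (_ : (n%:R * eps) * (n%:R * eps) <= _).
    by rewrite le_eqVlt; apply/orP; left; apply/eqP; ring.
  apply: le_trans h _.
  have -> : D * rnorm g * (D * rnorm g) = D ^+ 2 * rnorm g ^+ 2 by ring.
  have -> : n%:R * (4 * D ^+ 2) = D ^+ 2 * (4 * n%:R) by ring.
  by rewrite ler_wpM2l ?sqr_ge0.
have e20 : 0 < eps ^+ 2 by rewrite exprn_gt0.
have := key (Num.truncn (4 * D ^+ 2 / eps ^+ 2)).+1.
by rewrite -ler_pdivlMr// leNgt truncnS_gt.
Qed.

(** Generated by the complements of bounded sets of times; on the whole line this covers both ends
    at once. *)
Let at_infinity : set_system (time R J) :=
  [set A | exists M : R, forall a, M < `|set_val a| -> A a].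

Let at_infinity_filter : Filter at_infinity.
Proof.
split; first by exists 0.
  move=> A B [M AM] [N BN]; exists (Num.max M N) => a; rewrite gt_max => /andP[Ma Na].
  by split; [exact: AM|exact: BN].
by move=> A B AB [M AM]; exists M => a /AM /AB.
Qed.

Lemma translates_weak_cvg0 (U : set (weak (Cb J H))) :
  nbhs (0 : weak (Cb J H)) U ->
  exists M : R, forall a : time R J, M < `|set_val a| -> U (translate a f).
Proof.
have := at_infinity_filter => ?.
have : ((fun a => translate a f) @ at_infinity : set_system (weak (Cb J H))) -->
    (0 : weak (Cb J H)).
  apply: weak_cvg => phi; apply/cvgrPdist_le => r r0.
  have [eps rE] : exists eps : R, r = of_real eps.
    by exists (real_part r); rewrite of_real_ge0// ltW.
  move: r0; rewrite {}rE -of_real0 ltr_of_real => /(travelling_hump_weak_null phi)[M MP].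
  by exists M => a /MP aM /=; rewrite linear0 (@distrC K K^o) subr0.
by move=> h /h.
Qed.

Lemma travelling_hump_EAP0 : EAP0 f.
Proof.
have H_hilbert : is_hilbert H by exists ip.
have fL (t u : time R J) : rnorm (f t - f u) <= freq * `|set_val t - set_val u|.
  exact: travelling_hump_lipschitz.
split.
  apply: (@precompact_subset (weak (Cb J H)) _ ([set (0 : Cb J H)] `|` translation_orbit f)).
    by move=> g; right.
  apply: compact_precompact; first exact: weak_Cb_hilbert_hausdorff.
  apply: (@compact_cocompact_nbhs _ _ (0 : weak (Cb J H))); first by left.
  move=> U U0; have [M MP] := translates_weak_cvg0 U0.
  (* All translates outside the neighbourhood [U] of 0 have times in [[- M, M]], and such translates
     form a compact set. *)
  exists ((fun r => translate (tproj r) f) @` `[- M, M]).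
    exact: compact_translates freq0 fL.
  split=> [_ [r _ <-]|_ [->|[a _ <-]]]; first by right; exists (tproj r).
    by left; exact: (nbhs_singleton U0).
  have [Ma|aM] := ltP M `|set_val a|; first by left; exact: MP.
  right; exists (set_val a); last by rewrite tproj_set_val.
  by rewrite /= in_itv/= -ler_norml.
(* For the closure, the time [|M| + 1] lies in both time lines and beyond [M]. *)
move=> U /translates_weak_cvg0[M MP].
have v : set_val (@tproj R J (`|M| + 1)) = `|M| + 1.
  by apply: set_val_tproj; case: (J) => //=; rewrite in_itv/= andbT addr_ge0.
exists (translate (tproj (`|M| + 1)) f); split; first by exists (tproj (`|M| + 1)).
by apply: MP; rewrite v ger0_norm ?addr_ge0// (le_lt_trans (ler_norm _))// ltrDl.
Qed.

(** At [n + 1/2] the value is twice a unit vector, with a new direction for each [n], so these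
    values have squared mutual distance 8. A cluster point would be within 1 of two of them, giving
    at most 4. *)
Lemma travelling_hump_range : ~ precompact (range f).
Proof.
rewrite precompactE => cf.
pose u (n : nat) : H := F (n%:R + 2^-1).
have fu n : range f (u n).
  exists (tproj (n%:R + 2^-1)) => //.
  rewrite -[LHS]/(F (set_val _)) set_val_tproj//.
  by case: (J) => //=; rewrite in_itv/= andbT addr_ge0.
have [|x [_ xu]] := cf (u @ \oo) _.
  by exists 0%N => // n _; exact/subset_closure/fu.
have x1 : nbhs x [set y | rnorm (x - y) <= 1].
  by have /rnorm_cvgP/(_ 1 ltr01) : y @[y --> x] --> x by exact: cvg_id.
have later N : exists2 n, (N <= n)%N & rnorm (x - u n) <= 1.
  have [|y [[n Nn <-] ynx]] := xu (u @` [set n | (N <= n)%N]) _ _ x1.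
    by exists N => // n Nn; exists n.
  by exists n.
have [n _ xn] := later 0%N; have [m nm xm] := later n.+1.
have nm2 : rnorm (u n - u m) <= 2.
  have -> : u n - u m = (x - u m) - (x - u n) by rewrite opprB [RHS]addrC addrA subrK.
  by apply: le_trans (ler_rnormD _ _) _; rewrite rnormN; lra.
have : rnorm (u n - u m) ^+ 2 = 8.
  rewrite (rnorm_sqrD ipE).
    rewrite rnormN !rnorm_travelling_hump.
    have hk (k : nat) : hump (k%:R + 2^-1) = 2 :> R by exact: (hump_half k).
    by rewrite !hk; lra.
  rewrite -scaleN1r ipZr (ip_spread e_orthonormal) ?mulr0//.
  apply: floor_neq_far; rewrite opprD addrACA subrr addr0 distrC ger0_norm.
    by rewrite -natrB ?ler1n ?subn_gt0// ltnW.
  by rewrite subr_ge0 ler_nat ltnW.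
have : rnorm (u n - u m) * rnorm (u n - u m) <= 2 * 2.
  by apply: ler_pM; rewrite ?rnorm_ge0.
by rewrite expr2; lra.
Qed.

End travelling_hump.

(** * Means and Fourier coefficients of the travelling hump *)

Section travelling_hump_means.
Context {R : realType} {s : scalar_kind} {J : timeline}.
Context {H : completeNormedModType (scalars R s)}.
Variables (ip : {dot H for @conj_scalar R s}) (e : int -> H).
Hypothesis ipE : forall x : H, `|x| ^+ 2 = ip x x.
Hypothesis e_orthonormal : forall m n, ip (e m) (e n) = (m == n)%:R.

Local Notation F := (spread e hump).
Local Notation f := (travelling_hump (J := J) ipE e_orthonormal).

(** For [tau >= 1] the two values are orthogonal, so the squared distance is the sum of two squares,
    one of which is dropped. *)
Lemma ler_hump_dist (t tau : R) : 1 <= tau -> hump t <= rnorm (F (t + tau) - F t).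
Proof.
move=> tau1; rewrite -ler_sqr ?nnegrE ?rnorm_ge0 ?hump_ge0// (rnorm_sqrD ipE).
  by rewrite rnormN !(rnorm_travelling_hump ipE e_orthonormal) lerDr sqr_ge0.
rewrite -scaleN1r ipZr (ip_spread e_orthonormal) ?mulr0//.
by apply: floor_neq_far; rewrite addrAC subrr add0r ger0_norm//; lra.
Qed.

(* For an almost period tau >= 1 of g, F t and F (t + tau) are orthogonal, so
   hump t <= |h| t + |h| (t + tau) + 1/4; taking means yields 1 <= 1/4. *)
Lemma travelling_hump_not_PAP : ~ PAP f.
Proof.
move=> [g [h [[gR [_ gR_ap] gE] [I hI I0] fE]]].
have [|L L0 /(_ 1)[tau /andP[tau1 _] tauP]] := gR_ap 4^-1; first by rewrite invr_gt0.
(* [k] extends |h| continuously to the whole line through the retraction, so that it has an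
   antiderivative. *)
pose k (t : R) : R := rnorm (h (tproj t)).
have k_ge0 t : 0 <= k t by exact: rnorm_ge0.
have ck : continuous k.
  move=> t; apply: (@continuous_comp _ _ _ (h \o tproj) rnorm).
    by apply: continuous_comp; [exact: tproj_continuous|exact: Cb_continuous].
  exact: rnorm_continuous.
have FE t : tset J t -> F t = gR t + h (tproj t).
  move=> tJ; rewrite -{2}(set_val_tproj tJ).
  have := fE (tproj t); rewrite gE -[f (tproj t)]/(F (set_val (tproj t))).
  by rewrite {1}set_val_tproj.
have hump_le t : tset J t -> hump t <= k (t + tau) + k t + 4^-1.
  move=> tJ; have ttJ : tset J (t + tau).
    by case: (J) tJ => //=; rewrite !in_itv/= !andbT; lra.
  apply: le_trans (ler_hump_dist t tau1) _; rewrite !FE//.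
  rewrite opprD addrACA addrC; apply: le_trans (ler_rnormD _ _) _.
  apply: lerD (tauP t); apply: le_trans (ler_rnormD _ _) _.
  by rewrite rnormN.
(* [T] is so large that |h| has average at most 1/8 over both windows, and that the total deviation
   of [hump_prim] from the identity at the two ends, at most [2 / freq], is at most [T / 8]. *)
have [T [T1 Ttau Tw I1 I2]] : exists T : R, [/\ 1 <= T, tau <= T, 16 / freq <= T,
    `|I T| <= (T - window_left J T) / 8 &
    `|I (T + tau)| <= (T + tau - window_left J (T + tau)) / 8].
  move/(@rnorm_cvgP R RealScalars R^o): I0 => /(_ 8^-1).
  case; first by rewrite invr_gt0.
  move=> T0 [_ T0P].
  have IP T : T0 < T -> 0 < T -> `|I T| <= (T - window_left J T) / 8.
    move=> /T0P + Tp; rewrite sub0r rnormN window_weight rnorm_scalar.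
    have wl := window_length J Tp.
    have w0 : 0 < T - window_left J T by lra.
    rewrite -[X in `|X|]/((T - window_left J T)^-1 * I T) normrM normfV (gtr0_norm w0).
    by rewrite ler_pdivrMl.
  exists (Num.max (T0 + 1) (Num.max 1 (Num.max tau (16 / freq)))).
  set T := Num.max _ _.
  have : T0 + 1 <= T by rewrite le_max lexx.
  have T1 : 1 <= T by rewrite !le_max lexx !orbT.
  have Ttau : tau <= T by rewrite !le_max lexx !orbT.
  have Tw : 16 / freq <= T by rewrite !le_max lexx !orbT.
  by move=> T0T; split=> //; apply: IP; lra.
have [G dG] := @exists_antiderivative R k (- (T + tau)) (T + tau) ck.
have T0 : 0 < T by lra.
have Tt0 : 0 < T + tau by lra.
have /andP[a1 a2] := window_left_ge J T0.
have /andP[b1 b2] := window_left_ge J Tt0.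
have IG U : 0 < U -> U <= T + tau -> I U = G U - G (window_left J U).
  move=> U0 UT; have /andP[c1 c2] := window_left_ge J U0.
  apply: (@is_rint_antiderivative R k G (window_left J U) U); first by lra.
    by move=> x /andP[x1 x2]; apply: dG; lra.
  have := hI U U0; apply: is_riemann_integral_ext => t /andP[ta _].
  by rewrite (valL_tproj _ ta).
(* The window shifted by [tau] starts no earlier than the window of [T + tau], and [k] is
   nonnegative, so the integral of [k] over the shifted window is at most [I (T + tau)]. *)
have G_nd : G (window_left J (T + tau)) <= G (window_left J T + tau).
  have ab : window_left J (T + tau) <= window_left J T + tau.
    by case: (J) => /=; lra.
  have l2 : window_left J T + tau <= T + tau by lra.
  have [c _ GE] := mean_value dG b1 ab l2.
  by rewrite -subr_ge0 GE mulr_ge0// subr_ge0.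
(* A primitive of the slack in [hump_le], so its increment over the window is nonnegative. *)
pose D t : R := G (t + tau) + G t + 4^-1 * t - hump_prim t.
have dD t : window_left J T <= t <= T ->
    is_derive t 1 D (k (t + tau) + k t + 4^-1 - hump t).
  move=> /andP[ta tT].
  have d1 : is_derive t 1 (G \o (fun u => u + tau)) (k (t + tau) * 1).
    apply: is_derive1_comp; first by apply: dG; lra.
    by have := is_deriveD (is_derive_id t 1) (is_derive_cst tau t 1); rewrite addr0.
  have d2 : is_derive t 1 G (k t) by apply: dG; lra.
  have d3 : is_derive t 1 (4^-1 \*: @id R) (4^-1 *: (1 : R)) by exact: is_deriveZ.
  have := is_deriveB (is_deriveD (is_deriveD d1 d2) d3) (is_derive_hump_prim t).
  by rewrite mulr1 [_ *: 1]mulr1.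
have aT : window_left J T <= T by lra.
have [c /andP[ca cT] DE] := mean_value dD (lexx _) aT (lexx _).
have : 0 <= D T - D (window_left J T).
  rewrite DE mulr_ge0 ?subr_ge0//; apply: hump_le; exact: window_left_mem ca.
rewrite /D; have := ler_norm (I T); have := ler_norm (I (T + tau)).
have p1 := hump_prim_bound T; have p2 := hump_prim_bound (window_left J T).
move: p1 p2; rewrite !mul1r !ler_norml => /andP[p1 _] /andP[_ p2].
have JT : I T = G T - G (window_left J T) by apply: IG; lra.
have JTt : I (T + tau) = G (T + tau) - G (window_left J (T + tau)) by apply: IG; lra.
(* For a window of length w the integral of [hump] is at least 7w/8, while the three terms that
   should dominate it give at most w/4 + w/8 + w/4 = 5w/8. *)
have len2 : T + tau - window_left J (T + tau) <= 2 * (T - window_left J T).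
  by case: (J) => /=; lra.
have : 16 * freq^-1 <= T by [].
by lra.
Qed.

Lemma is_mean_absf_travelling_hump : is_mean (absf f) 1.
Proof.
apply: (is_mean_antiderivative (ltW freq_gt0) hump_lipschitz
  is_derive_hump_prim hump_prim_bound) => t.
exact: rnorm_travelling_hump.
Qed.

Lemma is_mean_absf2_travelling_hump : is_mean (absf2 f) (3 / 2).
Proof.
have f0 := @freq_gt0 R; have L0 : 0 <= 2 * freq + 2 * freq :> R by lra.
apply: (is_mean_antiderivative L0 hump_sqr_lipschitz
  is_derive_hump_sqr_prim hump_sqr_prim_bound) => t.
by rewrite -[LHS]/(rnorm (F (set_val t)) ^+ 2) (rnorm_travelling_hump ipE e_orthonormal).
Qed.

End travelling_hump_means.

Lemma cplx_norm2_0 (R : realType) (s : scalar_kind) (H : normedModType (scalars R s)) :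
  cplx_norm2 (0 : complexification H) = 0.
Proof.
case: s H => H.
  rewrite -[LHS]/(@rnorm R RealScalars H 0 ^+ 2 + @rnorm R RealScalars H 0 ^+ 2).
  by rewrite rnorm0 expr0n addr0.
by rewrite -[LHS]/(@rnorm R ComplexScalars H 0 ^+ 2) rnorm0 expr0n.
Qed.

Section fourier_coefficients.
Context {R : realType}.

(** Multiplying [hump] by a phase keeps the zeros at the integers, the bound 2 and a Lipschitz
    estimate. The phases used are the real and imaginary parts of e^(-i lambda t). *)
Let mean_modulated (s : scalar_kind) (J : timeline)
    (H : completeNormedModType (scalars R s)) (ip : {dot H for @conj_scalar R s})
    (e : int -> H) (phase : R -> R) (lambda : R) :
  (forall x : H, `|x| ^+ 2 = ip x x) ->
  (forall m n, ip (e m) (e n) = (m == n)%:R) ->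
  (forall t, `|phase t| <= 1) ->
  (forall x y, `|phase x - phase y| <= `|lambda| * `|x - y|) ->
  is_mean (fun t : time R J => spread e (fun u => hump u * phase u) (set_val t)) 0.
Proof.
move=> ipE eo ph1 phL; have f0 := @freq_gt0 R.
apply: (@is_mean_spread _ _ _ _ _ ipE eo J _ (2 * `|lambda| + 1 * freq) 2).
- by rewrite addr_ge0 ?mulr_ge0// ltW.
- exact: (lipschitzM ler_norm_hump ph1 hump_lipschitz phL).
- by move=> n; rewrite hump_int mul0r.
- by move=> t; rewrite normrM -[leRHS]mulr1 ler_pM// ler_norm_hump.
Qed.

Lemma fourier_travelling_hump (s : scalar_kind) (J : timeline)
    (H : completeNormedModType (scalars R s)) (ip : {dot H for @conj_scalar R s})
    (e : int -> H) (ipE : forall x : H, `|x| ^+ 2 = ip x x)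
    (eo : forall m n, ip (e m) (e n) = (m == n)%:R) (lambda : R) :
  is_fourier_coefficient (travelling_hump (J := J) ipE eo) lambda 0.
Proof.
have mc := @mean_modulated s J H ip e (fun t => cos (lambda * t)) lambda ipE eo
  (fun t => cos_max _) (cosM_lipschitz lambda).
have sin1 t : `|- sin (lambda * t)| <= 1 by rewrite normrN sin_max.
have sinL x y :
    `|- sin (lambda * x) - - sin (lambda * y)| <= `|lambda| * `|x - y|.
  by rewrite -opprD normrN; exact: sinM_lipschitz.
have ms := @mean_modulated s J H ip e _ lambda ipE eo sin1 sinL.
rewrite /is_fourier_coefficient.
case: s H ip e ipE eo mc ms => H ip e ipE eo mc ms.
  (* Real scalars: the cosine part enters the first coordinate of [H * H] and the sine part the
     second; both embeddings are contractions and so preserve mean 0. *)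
  have linA : linear (fun x : H => (x, 0) : (H * H)%type).
    by move=> a u v; rewrite /= -[RHS]/(a *: u + v, a *: 0 + 0) scaler0 addr0.
  have linB : linear (fun x : H => (0, x) : (H * H)%type).
    by move=> a u v; rewrite /= -[RHS]/(a *: 0 + 0, a *: u + v) scaler0 addr0.
  pose A : {linear H -> (H * H)%type} := HB.pack (fun x : H => (x, 0) : (H * H)%type)
    (GRing.isLinear.Build _ _ _ _ _ linA).
  pose B : {linear H -> (H * H)%type} := HB.pack (fun x : H => (0, x) : (H * H)%type)
    (GRing.isLinear.Build _ _ _ _ _ linB).
  have A1 u : @rnorm R RealScalars _ (A u) <= rnorm u.
    by rewrite -[leLHS]/(`|(u, 0)|) prod_normE/= normr0 max_l.
  have B1 u : @rnorm R RealScalars _ (B u) <= rnorm u.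
    by rewrite -[leLHS]/(`|(0, u)|) prod_normE/= normr0 max_r.
  have := is_meanD (is_mean_comp A1 mc) (is_mean_comp B1 ms); rewrite addr0.
  congr is_mean; apply/funext => t.
  rewrite -[RHS]/(cos (lambda * set_val t) *: spread e hump (set_val t),
                  - sin (lambda * set_val t) *: spread e hump (set_val t)).
  rewrite -[LHS]/(spread e (fun u : R => hump u * cos (lambda * u)) (set_val t) + 0,
    0 + spread e (fun u : R => hump u * - sin (lambda * u)) (set_val t)).
  by rewrite addr0 add0r /spread/= !scalerA [hump _ * cos _]mulrC [hump _ * - _]mulrC.
(* Complex scalars: e^(-i theta) = cos theta + i (- sin theta), and multiplication by i does not
   increase norms. *)
have linC : linear (fun x : H => 'i%C *: x).
  by move=> a u v; rewrite scalerDr !scalerA mulrC.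
pose C : {linear H -> H} := HB.pack (fun x : H => 'i%C *: x)
  (GRing.isLinear.Build _ _ _ _ _ linC).
have C1 u : rnorm (C u) <= rnorm u.
  have i1 : `|'i%C : R[i]| = 1 by rewrite normc_def/= expr0n expr1n add0r sqrtr1.
  by rewrite rnormZ [X in real_part X]i1 mul1r.
have := is_meanD mc (is_mean_comp C1 ms); rewrite addr0.
congr is_mean; apply/funext => t.
rewrite -[RHS]/((cos (lambda * set_val t) -i* sin (lambda * set_val t))%C *:
  spread e hump (set_val t)).
rewrite -[LHS]/(spread e (fun u : R => hump u * cos (lambda * u)) (set_val t) +
  'i%C *: spread e (fun u : R => hump u * - sin (lambda * u)) (set_val t)).
rewrite /spread !scalerA -scalerDl; congr (_ *: _).
move: (hump _) (cos _) (sin _) => h c d; apply/eqP.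
by rewrite eq_complex/=; apply/andP; split; apply/eqP; ring.
Qed.

Lemma not_parseval_travelling_hump (s : scalar_kind) (J : timeline)
    (H : completeNormedModType (scalars R s)) (ip : {dot H for @conj_scalar R s})
    (e : int -> H) (ipE : forall x : H, `|x| ^+ 2 = ip x x)
    (eo : forall m n, ip (e m) (e n) = (m == n)%:R) :
  ~ parseval (travelling_hump (J := J) ipE eo).
Proof.
move=> [m [c [mP cP mE]]].
have c0 lambda : cplx_norm2 (c lambda) = 0.
  rewrite (is_mean_unique (cP lambda) (fourier_travelling_hump J ipE eo lambda)).
  exact: cplx_norm2_0.
have [m0] : m%:E = 0%:E.
  by rewrite mE; apply: esum1 => lambda _; rewrite c0.
have := is_mean_unique mP (is_mean_absf2_travelling_hump ipE eo).
by rewrite m0; lra.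
Qed.

End fourier_coefficients.

(** * The travelling hump as the required example *)

Theorem mainTheorem2 (R : realType) (s : scalar_kind) (J : timeline)
    (H : completeNormedModType (scalars R s))
    (H_hilbert : is_hilbert H)
    (H_separable : separable H)
    (H_infinite : ~ finite_dimensional H) :
  exists2 f : Cb J H, EAP0 f &
    [/\ [/\ AP (absf f), AP (absf2 f), EAP (absf f) & EAP (absf2 f)],
        ~ precompact (range f),
        (exists2 m : R, is_mean (absf f) m & 0 < m) /\
        (exists2 m : R, is_mean (absf2 f) m & 0 < m)
      & [/\ exists c : R -> complexification H,
              forall lambda : R, is_fourier_coefficient f lambda (c lambda),
            ~ parseval f
          & ~ PAP f]].
Proof.
have [ip ipE] := H_hilbert.
have [b bo] := exists_orthonormal_sequence ipE H_infinite.
(* [pickle] injects the integers into the naturals, so the cells left of 0 receive directions of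
   their own as well. *)
pose e (n : int) := b (pickle n).
have eo m n : ip (e m) (e n) = (m == n)%:R.
  by rewrite bo (inj_eq (pcan_inj pickleK)).
pose f := travelling_hump (J := J) ipE eo.
have fE t : absf f t = hump (set_val t) by exact: rnorm_travelling_hump.
have f2E t : absf2 f t = hump (set_val t) ^+ 2.
  by rewrite -[LHS]/(rnorm (spread e hump (set_val t)) ^+ 2) (rnorm_travelling_hump ipE eo).
have f0 := ltW (@freq_gt0 R).
have f20 : 0 <= 2 * freq + 2 * freq :> R by lra.
have per2 t (n : int) : hump (t + n%:~R) ^+ 2 = hump t ^+ 2 :> R by rewrite humpDint.
exists f; first exact: travelling_hump_EAP0.
split.
- split.
  + exact: (periodic_AP hump_lipschitz humpDint fE).
  + exact: (periodic_AP hump_sqr_lipschitz per2 f2E).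
  + exact: (periodic_EAP f0 hump_lipschitz humpDint fE).
  + exact: (periodic_EAP f20 hump_sqr_lipschitz per2 f2E).
- exact: travelling_hump_range.
- split; [exists 1 => //|exists (3 / 2); last by lra].
    exact: is_mean_absf_travelling_hump.
  exact: is_mean_absf2_travelling_hump.
- split; [|exact: not_parseval_travelling_hump|exact: travelling_hump_not_PAP].
  by exists (fun=> 0) => lambda; exact: fourier_travelling_hump.
Qed.
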